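(* Let $Z_n$ be uniformly distributed on the ball $B(n)$, with cursor $\pi(Z_n)$, hull length $L_n=L(Z_n)$ and lamp count $m_n=m(Z_n)$. Then, with exponentially small exception probabilities, $$\frac{|\pi(Z_n)|}{n}\to\bar\beta,\qquad \frac{L_n}{n}\to\bar\beta,\qquad \frac{m_n}{n}\to1-\bar\beta$$ in probability; in particular $(L_n-|\pi(Z_n)|)/n\to0$, so a typical element of the ball is ballistic (it has no macroscopic backtracking). Moreover $\pi(Z_n)/n$ satisfies a large deviation principle with speed $n$ and rate function $J=\log\omega-I$, which vanishes exactly at $\pm\bar\beta$ and is affine on $[-\beta^{*},\beta^{*}]$.
   Context: Let $F$ be a finite group with identity $e$ and $|F|=r+1\ge2$. Let $L_F=F\wr\mathbb{Z}$ be the group of pairs $x=(\eta,j)$ with $\eta:\mathbb{Z}\to F$ finitely supported and $j\in\mathbb{Z}$, with multiplication $(\eta,j)(\eta',j')=(\eta\cdot\tau_j\eta',\,j+j')$, where $\tau_j\eta'(i)=\eta'(i-j)$ and the product of configurations is pointwise in $F$. The standard generating set is $S=\{t^{\pm1}\}\cup(F\setminus\{e\})$, where $t=(\mathbf{e},1)$ with $\mathbf e$ the trivial configuration, and $c\in F\setminus\{e\}$ is identified with $(\delta^c,0)$, $\delta^c$ being equal to $c$ at $0$ and trivial elsewhere. Let $|x|$ be the word length with respect to $S$, $B(n)=\{x\in L_F:|x|\le n\}$, and $\pi(\eta,j)=j$ the cursor homomorphism. For $x=(\eta,j)$ let $m(x)=|\operatorname{supp}\eta|$ be the lamp count (number of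 $i$ with $\eta(i)\ne e$), let $[a,b]$ be the smallest interval containing $\operatorname{supp}\eta\cup\{0,j\}$, and let $L(x)=b-a$ be the hull length; the quantity $L(x)-|j|\ge0$ measures the backtracking of a geodesic representative of $x$. For $j\in\mathbb{Z}$, $n\ge0$ put $N_j(n)=\#\{x\in B(n):\pi(x)=j\}$. The directional growth spectrum is $I(\beta)=\lim_{n\to\infty}\frac1n\log N_{\lfloor\beta n\rfloor}(n)$ for $\beta\in[-1,1]$ (the limit exists for every such $\beta$). Let $\rho>1$ be the unique real number $>1$ with $\rho^3=\rho+r$, $\omega=\frac{1+\sqrt{1+4r}}2$ (so $\omega^2=\omega+r$), $u_r=r/(r+\rho)$, $\beta^{*}=\frac1{1+u_r}$, $\bar\beta=\frac{\omega^2}{\omega^2+r}$. ''With exponentially small exception probabilities'' means: for every $\varepsilon>0$ the probability that the triple $(|\pi(Z_n)|/n,\,L_n/n,\,m_n/n)$ lies outside the $\varepsilon$-neighborhood of $(\bar\beta,\bar\beta,1-\bar\beta)$ decays exponentially in $n$. Large deviation principle with speed $n$ and rate function $J$: for the laws $\nu_n$ of $\pi(Z_n)/n$, $\limsup_n\frac1n\log\nu_n(A)\le-\inf_AJ$ for every closed $A\subset[-1,1]$ and $\liminf_n\frac1n\log\nu_n(G)\ge-\inf_GJ$ for every relatively open $G\subset[-1,1]$.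
   Formalization: The rate function J is stated to be an affine function of |β| on [-β*, β*] (affine on each half, with a corner at 0); literally affine on the whole interval is false, since J(β) = log ω − (1+|β|) log ρ there. *)

(* Defs.v *)
From HB Require Import structures.
From mathcomp Require Import all_boot all_order all_algebra all_fingroup finmap.
From mathcomp Require Import all_classical all_reals all_analysis.
Import Order.TTheory GRing.Theory Num.Theory.
Import numFieldNormedType.Exports.

Set Implicit Arguments.
Unset Strict Implicit.
Unset Printing Implicit Defensive.

Local Open Scope classical_set_scope.
Local Open Scope ring_scope.

(* The lamplighter group L_F = F wr Z: finitely supported configurations
   int -> F together with a cursor position. *)
Definition lamplighter (F : finGroupType) : Type :=
  ({fsfun int -> F with 1%g} * int)%type.

HB.instance Definition _ (F : finGroupType) := Choice.on (lamplighter F).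

Section Lamplighter.
Variable F : finGroupType.
Local Notation L := (lamplighter F).
Implicit Types (x y z : L) (c : F).

Definition lamps x : {fsfun int -> F with 1%g} := x.1.
Definition cursor x : int := x.2.

Definition lamp_one : L := ([fsfun with 1%g], 0).

Definition lamp_mul x y : L :=
  ([fsfun i in (finsupp (lamps x) `|`
                [fset (k + cursor x)%R | k in finsupp (lamps y)])%fset
     => (lamps x i * lamps y (i - cursor x)%R)%g],
   cursor x + cursor y).

Definition lamp_inv x : L :=
  ([fsfun i in [fset (k - cursor x)%R | k in finsupp (lamps x)]%fset
     => ((lamps x (i + cursor x)%R)^-1)%g],
   - cursor x).

Lemma lamp_eqP x y : lamps x =1 lamps y -> cursor x = cursor y -> x = y.
Proof. by case: x y => [e j] [e' j'] /= /fsfunP -> ->. Qed.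

Lemma lamps_mul x y i :
  lamps (lamp_mul x y) i = (lamps x i * lamps y (i - cursor x)%R)%g.
Proof.
rewrite /lamps /= fsfunE; case: ifPn => //.
rewrite in_fsetU negb_or => /andP[xi yi].
rewrite (fsfun_dflt xi) mul1g fsfun_dflt //.
apply: contra yi => yi; apply/imfsetP; exists (i - cursor x) => //.
by rewrite subrK.
Qed.

Lemma lamps_inv x i :
  lamps (lamp_inv x) i = ((lamps x (i + cursor x)%R)^-1)%g.
Proof.
rewrite /lamps /= fsfunE; case: ifPn => // xi.
rewrite fsfun_dflt ?invg1 //; apply: contra xi => xi.
by apply/imfsetP; exists (i + cursor x) => //; rewrite addrK.
Qed.

Lemma lamps_one i : lamps lamp_one i = 1%g.
Proof. by rewrite /lamps /= fsfunE. Qed.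

Lemma lamp_mulA : associative lamp_mul.
Proof.
move=> x y z; apply: lamp_eqP => [i|]; last exact: addrA.
by rewrite !lamps_mul mulgA /= opprD addrA.
Qed.

Lemma lamp_mul1 : left_id lamp_one lamp_mul.
Proof.
move=> x; apply: lamp_eqP => [i|]; last exact: add0r.
by rewrite lamps_mul lamps_one mul1g /= subr0.
Qed.

Lemma lamp_mulr1 : right_id lamp_one lamp_mul.
Proof.
move=> x; apply: lamp_eqP => [i|]; last exact: addr0.
by rewrite lamps_mul lamps_one mulg1.
Qed.

Lemma lamp_mulV : left_inverse lamp_one lamp_inv lamp_mul.
Proof.
move=> x; apply: lamp_eqP => [i|]; last exact: addNr.
by rewrite lamps_mul lamps_one lamps_inv /= opprK mulVg.
Qed.

Lemma lamp_mulrV : right_inverse lamp_one lamp_inv lamp_mul.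
Proof.
move=> x; apply: lamp_eqP => [i|]; last exact: subrr.
by rewrite lamps_mul lamps_one lamps_inv subrK mulgV.
Qed.

End Lamplighter.

HB.instance Definition _ (F : finGroupType) :=
  isGroup.Build (lamplighter F) (@lamp_mulA F) (@lamp_mul1 F) (@lamp_mulr1 F)
    (@lamp_mulV F) (@lamp_mulrV F).

HB.instance Definition _ (F : finGroupType) :=
  isPointed.Build (lamplighter F) (@lamp_one F).

HB.instance Definition _ (F : finGroupType) :=
  @isMeasurable.Build default_measure_display (lamplighter F)
    (@discrete_measurable (lamplighter F)) (@discrete_measurable0 _)
    (@discrete_measurableC _) (@discrete_measurableU _).

Section WordMetric.
Variable F : finGroupType.
Local Notation L := (lamplighter F).
Implicit Types (x y : L) (c : F).

Definition shift : L := ([fsfun with 1%g], 1).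
Definition lamp c : L := ([fsfun [fsfun with 1%g] with 0 |-> c], 0).

Definition lamp_gens : set L :=
  [set x | x = shift \/ x = (shift^-1)%g \/ exists2 c, c != 1%g & x = lamp c].

Definition word_for x (w : seq L) :=
  (forall s, s \in w -> lamp_gens s) /\ (\prod_(s <- w) s)%g = x.

Let spelled x := exists w, word_for x w.

Let spelled_gen x : lamp_gens x -> spelled x.
Proof.
move=> gx; exists [:: x]; split; last by rewrite big_seq1.
by move=> s; rewrite inE => /eqP ->.
Qed.

Let spelled1 : spelled 1%g.
Proof. by exists [::]; split => //; rewrite big_nil. Qed.

Let spelledM x y : spelled x -> spelled y -> spelled (x * y)%g.
Proof.
move=> [w [gw <-]] [v [gv <-]]; exists (w ++ v); split; last first.
  by rewrite big_cat.
by move=> s; rewrite mem_cat => /orP[/gw|/gv].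
Qed.

Let trans (i : int) : L := ([fsfun with 1%g], i).

Let spelled_trans i : spelled (trans i).
Proof.
have tD k l : trans (k + l) = (trans k * trans l)%g.
  by apply: lamp_eqP => // m; rewrite lamps_mul /lamps /= !fsfunE mulg1.
have tV k : trans (- k) = ((trans k)^-1)%g.
  by apply: lamp_eqP => // m; rewrite lamps_inv /lamps /= !fsfunE invg1.
have st : spelled (trans 1) by apply: spelled_gen; left.
have sV : spelled (trans (- 1)) by apply: spelled_gen; right; left; exact: tV.
elim: i => [|n IHn|n IHn]; first exact: spelled1.
- by rewrite -addn1 PoszD tD; exact: spelledM.
- by rewrite -addn1 PoszD opprD tD; exact: spelledM.
Qed.

Let spelled_all x : spelled x.
Proof.
have [n le_n] := ubnP #|` finsupp (lamps x)|.
elim: n => // n IHn in x le_n *.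
have [s0|[i si]] := fset_0Vmem (finsupp (lamps x)).
  suff -> : x = trans (cursor x) by [].
  apply: lamp_eqP => // k; rewrite /lamps /= fsfunE.
  by rewrite fsfun_dflt // -/(lamps x) s0.
pose y : L := ([fsfun lamps x without i], cursor x).
have ->: x = (trans i * lamp (lamps x i) * trans (- i) * y)%g.
  apply: lamp_eqP => [k|]; last by rewrite /= addr0 subrr add0r.
  have lampE c m : lamps (lamp c) m = if m == 0 then c else 1%g.
    by rewrite /lamps fsfun_withE fsfun0E.
  have yE : lamps y k = if k == i then 1%g else lamps x k.
    by rewrite {1}/lamps fsfun_withE.
  rewrite !lamps_mul lampE /lamps /= !fsfun0E mul1g mulg1 addr0 subrr subr0.
  rewrite -/(lamps y) yE subr_eq0.
  by have [->|_] := eqVneq k i; rewrite ?mulg1 ?mul1g.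
have sy : spelled y.
  apply: IHn; rewrite /lamps /= (finsupp_without _ _ i).
  by move: le_n; rewrite (cardfsD1 i) si.
apply: (spelledM _ sy); apply: (spelledM _ (spelled_trans _)).
apply: (spelledM (spelled_trans _)); apply: spelled_gen; right; right.
by exists (lamps x i) => //; rewrite -mem_finsupp.
Qed.

Lemma lamp_gens_generate x :
  exists n, `[< exists2 w, size w = n & word_for x w >].
Proof. by have [w xw] := spelled_all x; exists (size w); apply/asboolP; exists w. Qed.

Definition word_length x : nat := ex_minn (lamp_gens_generate x).

Definition lamp_ball (n : nat) : set L := [set x | (word_length x <= n)%N].

(* Balls are finite, so that counting with [fset_set] below is meaningful. *)
Lemma finite_lamp_ball n : finite_set (lamp_ball n).
Proof.
have fg : finite_set lamp_gens.
  apply: (@sub_finite_set _ _ ([set shift; (shift^-1)%g] `|` range lamp)).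
    by move=> x [->|[->|[c _ ->]]]; [left; left|left; right|right; exists c].
  rewrite finite_setU; split; first exact: finite_set2.
  by apply: finite_image; exact: finite_finset.
pose W k : set L := [set x | exists2 w, size w = k & word_for x w].
have fW k : finite_set (W k).
  elim: k => [|k IHk].
    apply: (@sub_finite_set _ _ [set 1%g]); last exact: finite_set1.
    by move=> x [w /size0nil -> [_ <-]]; rewrite big_nil.
  apply: (@sub_finite_set _ _
    ((fun p => (p.1 * p.2)%g) @` (lamp_gens `*` W k))).
    move=> x [[|s w] //= [sw] [gw <-]]; exists (s, (\prod_(s <- w) s)%g).
      split => /=; first by apply: gw; rewrite mem_head.
      by exists w => //; split=> // u uw; apply: gw; rewrite inE uw orbT.
    by rewrite big_cons.
  by apply: finite_image; exact: finite_setX.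
apply: (@sub_finite_set _ _ (\bigcup_(k in `I_n.+1) W k)).
  move=> x; rewrite /lamp_ball /word_length /=; case: ex_minnP => k.
  by move=> /asboolP xk _ kn; exists k.
by apply: bigcup_finite => //; exact: finite_II.
Qed.

Definition lamp_count x : nat := #|` finsupp (lamps x)|.

Definition hull_min x : int :=
  \big[Num.min/Num.min 0 (cursor x)]_(i <- finsupp (lamps x)) i.
Definition hull_max x : int :=
  \big[Num.max/Num.max 0 (cursor x)]_(i <- finsupp (lamps x)) i.
Definition hull_length x : int := hull_max x - hull_min x.

Definition cursor_count (j : int) (n : nat) : nat :=
  #|` fset_set [set x | lamp_ball n x /\ cursor x = j]|.

End WordMetric.

Section Probability.
Variable R : realType.

Definition growth_spectrum (F : finGroupType) (b : R) : R :=
  limn (fun n : nat =>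
    n%:R^-1 * ln (cursor_count F (Num.floor (b * n%:R)) n)%:R : R).

Definition uniform_on (F : finGroupType) (d : measure_display)
    (T : measurableType d) (P : probability T R)
    (Z : {RV P >-> lamplighter F}) (B : set (lamplighter F)) :=
  forall A : set (lamplighter F),
    distribution P Z A
    = ((#|` fset_set (A `&` B)|)%:R / (#|` fset_set B|)%:R)%:E.

(* Convergence in probability to a constant, and exponential decay; the
   random variables may live on different probability spaces. *)
Definition cvg_in_prob (d : nat -> measure_display)
    (T : forall n, measurableType (d n)) (P : forall n, probability (T n) R)
    (X : forall n, T n -> R) (l : R) :=
  forall e : R, 0 < e ->
    (fun n => P n [set w | e <= `|X n w - l|]) @ \oo --> 0%E.

Definition exponentially_small (p : nat -> \bar R) :=
  exists C c : R, [/\ 0 < C, 0 < c &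
    forall n, (0 < n)%N -> (p n <= (C * expR (- (c * n%:R)))%:E)%E].

(* Large deviation principle on [-1, 1] at speed n; the infimum over the
   empty set is +oo and the logarithm of 0 is -oo. *)
Definition large_deviation_principle (nu : nat -> set R -> \bar R)
    (J : R -> R) :=
  (forall A : set R, closed A -> A `<=` `[-1, 1] ->
    (limn_esup (fun n => (n%:R^-1)%:E * lne (nu n A))
      <= - ereal_inf [set (J x)%:E | x in A])%E) /\
  (forall U : set R, open U ->
    let G := U `&` `[-1, 1] in
    (- ereal_inf [set (J x)%:E | x in G]
      <= limn_einf (fun n => (n%:R^-1)%:E * lne (nu n G)))%E).

End Probability.

(* Main.v *)
(* An element with lamp count [m], hull length [L] and cursor [j] has length at
   least [m + 2 L - |j|] (exactly that, in fact), so only the triple [(m, L, j)]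
   matters.  Giving each lamp weight [z], a hull with [L + 1] sites carries total
   weight [(1 + r z) ^ (L + 1)]; the ball meets only polynomially many hulls, so a
   family on which [(1 + r z) ^ (L + 1) <= E * z ^ m] has at most [E] elements up
   to a polynomial factor.  With [z <= 1 / rho], where [z ^ 2 (1 + r z) <= 1],
   backtracking does not help and the elements of cursor [b n] number at most
   [exp (n (|b| ln (1 + r z) - (1 - |b|) ln z))].  The optimal [z] is the one that
   gives the binomial weights their mode at the available number of lamps, so the
   largest binomial term provides the matching lower bound; below [beta_star] the
   optimum sticks at [z = 1 / rho] and the spectrum is affine.  At [z = 1 / omega],
   where [z (1 + r z) = 1], the exponent is [ln omega] for every [b], and Gibbs'
   inequality makes [beta_bar] the only maximiser. *)

Require Import Defs.
From HB Require Import structures.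
From mathcomp Require Import all_boot all_order all_algebra all_fingroup finmap.
From mathcomp Require Import all_classical all_reals all_analysis.
From mathcomp Require Import ring lra zify.
Import Order.TTheory GRing.Theory Num.Theory.
Import numFieldNormedType.Exports.
Local Open Scope classical_set_scope.
Local Open Scope ring_scope.

Set Implicit Arguments.
Unset Strict Implicit.
Unset Printing Implicit Defensive.

(** * Word length *)

Section WordLength.
Variable F : finGroupType.
Implicit Types (x y g : lamplighter F) (c : F).

Lemma word_length_le x w : word_for x w -> (word_length x <= size w)%N.
Proof.
move=> xw; rewrite /word_length; case: ex_minnP => n _; apply.
by apply/asboolP; exists w.
Qed.

Lemma shortest_word x : exists2 w, size w = word_length x & word_for x w.
Proof. by rewrite /word_length; case: ex_minnP => n /asboolP. Qed.

Lemma word_length1 : word_length (1%g : lamplighter F) = 0%N.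
Proof.
apply/eqP; rewrite -leqn0; apply: (@word_length_le _ [::]); split=> //.
by rewrite big_nil.
Qed.

Lemma word_length_gen g : lamp_gens g -> (word_length g <= 1)%N.
Proof.
move=> gg; apply: (@word_length_le _ [:: g]); split; last by rewrite big_seq1.
by move=> s; rewrite inE => /eqP ->.
Qed.

Lemma word_lengthM x y :
  (word_length (x * y)%g <= word_length x + word_length y)%N.
Proof.
have [w <- [gw <-]] := shortest_word x; have [v <- [gv <-]] := shortest_word y.
rewrite -size_cat; apply: word_length_le; split; last by rewrite big_cat.
by move=> s; rewrite mem_cat => /orP[/gw|/gv].
Qed.

Lemma word_lengthX x n : (word_length (x ^+ n)%g <= n * word_length x)%N.
Proof.
elim: n => [|n IHn]; first by rewrite expg0 word_length1.
by rewrite expgS mulSn; apply: leq_trans (word_lengthM _ _) _; rewrite leq_add2l.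
Qed.

Lemma lampsM x y i : lamps (x * y)%g i = (lamps x i * lamps y (i - cursor x)%R)%g.
Proof. exact: lamps_mul. Qed.

Lemma lamps_lamp c i : lamps (lamp c) i = if i == 0 then c else 1%g.
Proof. by rewrite /lamps fsfun_withE fsfun0E. Qed.

Lemma lamps_shift i : lamps (@Defs.shift F) i = 1%g.
Proof. by rewrite /lamps fsfun0E. Qed.

Lemma lamps_shiftV i : lamps ((@Defs.shift F)^-1)%g i = 1%g.
Proof. by rewrite lamps_inv lamps_shift invg1. Qed.

Lemma mem_lamps x i : (i \in finsupp (lamps x)) = (lamps x i != 1%g).
Proof. by rewrite mem_finsupp. Qed.

Lemma lamp_count_shift x g : (forall i, lamps g i = 1%g) ->
  lamp_count (x * g)%g = lamp_count x.
Proof.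
move=> g1; rewrite /lamp_count; congr (#|` _|); apply/fsetP => i.
by rewrite !mem_lamps lampsM g1 mulg1.
Qed.

Lemma lamp_count_lamp x c : (lamp_count (x * lamp c)%g <= (lamp_count x).+1)%N.
Proof.
rewrite /lamp_count.
have: (finsupp (lamps (x * lamp c)%g) `<=` cursor x |` finsupp (lamps x))%fset.
  apply/fsubsetP => i; rewrite in_fset1U !mem_lamps lampsM lamps_lamp subr_eq0.
  by have [->|_] := eqVneq i (cursor x); rewrite ?mulg1.
move/fsubset_leq_card/leq_trans; apply; rewrite cardfsU1.
by case: (_ \notin _); rewrite ?add1n ?add0n.
Qed.

(* The hull of a word's trajectory can only exceed the hull of its endpoint,
   so the potential is tracked with an arbitrary enclosing interval [a, b]. *)
Lemma word_hull x w : word_for x w ->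
  exists a b : int, [/\ a <= 0 <= b, a <= cursor x <= b,
    forall i, lamps x i != 1%g -> a <= i <= b &
    (lamp_count x)%:Z + 2 * (b - a) - `|cursor x| <= (size w)%:Z].
Proof.
elim/last_ind: w x => [|w g IHw] y [gw <-].
  rewrite big_nil; exists 0, 0; split=> //; first by move=> i; rewrite lamps_one eqxx.
  suff -> : lamp_count (1%g : lamplighter F) = 0%N by [].
  apply/eqP; rewrite cardfs_eq0; apply/eqP/fsetP => i.
  by rewrite mem_lamps lamps_one eqxx in_fset0.
have {y}-> : (\prod_(s <- rcons w g) s = (\prod_(s <- w) s) * g)%g.
  by rewrite big_rcons.
have [|a [b []]] := IHw (\prod_(s <- w) s)%g.
  by split=> // s sw; apply: gw; rewrite mem_rcons inE sw orbT.
rewrite size_rcons; set x := (\prod_(s <- w) s)%g => ab xab sab le_w.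
have cM y : cursor (x * y)%g = cursor x + cursor y by [].
have [->|[->|[c c1 ->]]] : lamp_gens g by apply: gw; rewrite mem_rcons mem_head.
- exists a, (Num.max b (cursor x + 1)); rewrite lamp_count_shift; last exact: lamps_shift.
  rewrite cM; have -> : cursor (@Defs.shift F) = 1 by [].
  split; [lia|lia| |lia].
  by move=> i; rewrite lampsM lamps_shift mulg1 => /sab; lia.
- exists (Num.min a (cursor x - 1)), b; rewrite lamp_count_shift; last exact: lamps_shiftV.
  rewrite cM; have -> : cursor ((@Defs.shift F)^-1)%g = -1 by [].
  split; [lia|lia| |lia].
  by move=> i; rewrite lampsM lamps_shiftV mulg1 => /sab; lia.
exists a, b; rewrite cM; have -> : cursor (lamp c) = 0 by [].
rewrite addr0; split=> //; last first.
  move: le_w (lamp_count_lamp x c).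
  by set u := lamp_count (x * _)%g; set v := lamp_count x; lia.
move=> i; rewrite lampsM lamps_lamp subr_eq0.
by have [->|_] := eqVneq i (cursor x); [move=> _|rewrite mulg1; apply: sab].
Qed.

Lemma hull_min_le x : hull_min x <= 0 /\ hull_min x <= cursor x.
Proof.
have : hull_min x <= Num.min 0 (cursor x) by exact: bigmin_le_id.
by lia.
Qed.

Lemma hull_max_ge x : 0 <= hull_max x /\ cursor x <= hull_max x.
Proof.
have : Num.max 0 (cursor x) <= hull_max x by exact: bigmax_ge_id.
by lia.
Qed.

Lemma lamps_hull x i : lamps x i != 1%g -> hull_min x <= i <= hull_max x.
Proof.
rewrite -mem_lamps => si; rewrite /hull_min /hull_max.
by rewrite ge_bigmin_seq // le_bigmax_seq.
Qed.

(** Any interval enclosing a word's trajectory contains the hull of its endpoint, so the bound of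
    [word_hull] survives when [b - a] is replaced by the hull length. *)
Lemma word_length_ge x :
  (lamp_count x)%:Z + 2 * hull_length x - `|cursor x| <= (word_length x)%:Z.
Proof.
have [w <- xw] := shortest_word x.
have [a [b [ab xab sab le_w]]] := word_hull xw.
have ha : a <= hull_min x.
  rewrite /hull_min big_seq_cond; apply: le_bigmin; first by lia.
  by move=> i; rewrite mem_lamps andbT => /sab /andP[].
have hb : hull_max x <= b.
  rewrite /hull_max big_seq_cond; apply: bigmax_le; first by lia.
  by move=> i; rewrite mem_lamps andbT => /sab /andP[].
rewrite /hull_length; lia.
Qed.

End WordLength.

(** * Explicit words: one-way sweeps and detours *)

Section Walks.
Variable F : finGroupType.
Implicit Types (x y g : lamplighter F) (c : F) (s : bool) (w : seq F).

Lemma lamp1 : lamp (1%g : F) = 1%g.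
Proof.
apply: lamp_eqP => // i; rewrite lamps_lamp.
by rewrite [RHS]lamps_one; case: (i == 0).
Qed.

Lemma word_length_lamp c : (word_length (lamp c) <= (c != 1%g))%N.
Proof.
have [->|c1] := eqVneq c 1%g; first by rewrite lamp1 word_length1.
by apply: word_length_gen; right; right; exists c.
Qed.

Definition step s : lamplighter F :=
  if s then ((@Defs.shift F)^-1)%g else Defs.shift F.

Lemma word_length_step s : (word_length (step s) <= 1)%N.
Proof. by apply: word_length_gen; case: s; [right; left|left]. Qed.

Lemma lamps_step s i : lamps (step s) i = 1%g.
Proof. by case: s; [exact: lamps_shiftV|exact: lamps_shift]. Qed.

Lemma cursor_step s : cursor (step s) = (-1) ^+ s.
Proof. by case: s. Qed.

Lemma cursorM x y : cursor (x * y)%g = cursor x + cursor y.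
Proof. by []. Qed.

Lemma cursorX x n : cursor (x ^+ n)%g = cursor x * n%:Z.
Proof.
elim: n => [|n IHn]; first by rewrite mulr0.
by rewrite expgS cursorM IHn -add1n PoszD mulrDr mulr1.
Qed.

Lemma lampsM_shift x y i : (forall i, lamps y i = 1%g) ->
  lamps (x * y)%g i = lamps x i.
Proof. by move=> y1; rewrite lampsM y1 mulg1. Qed.

Lemma lamps_stepX s n i : lamps (step s ^+ n)%g i = 1%g.
Proof.
elim: n i => [|n IHn] i; first by rewrite expg0 [LHS]lamps_one.
by rewrite expgS lampsM_shift // lamps_step.
Qed.

(** A one-way sweep that writes [w] on consecutive sites and stops just past the last one;
    [s = true] means leftwards. *)
Definition walk s w : lamplighter F := (\prod_(c <- w) (lamp c * step s))%g.

Lemma walk_rcons s w c : walk s (rcons w c) = (walk s w * (lamp c * step s))%g.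
Proof. by rewrite /walk big_rcons. Qed.

Lemma cursor_walk s w : cursor (walk s w) = (-1) ^+ s * (size w)%:Z.
Proof.
elim/last_ind: w => [|w c IHw]; first by rewrite /walk big_nil mulr0.
rewrite walk_rcons !cursorM IHw size_rcons cursor_step add0r -addn1 PoszD.
by rewrite mulrDr mulr1.
Qed.

Lemma lamps_walk s w (i : nat) : lamps (walk s w) ((-1) ^+ s * i%:Z) = nth 1%g w i.
Proof.
elim/last_ind: w i => [|w c IHw] i; first by rewrite /walk big_nil nth_nil [LHS]lamps_one.
rewrite walk_rcons mulgA lampsM_shift; last exact: lamps_step.
rewrite lampsM IHw lamps_lamp cursor_walk subr_eq0 nth_rcons.
rewrite (inj_eq (mulrI _)) ?unitrX ?unitrN1 //.
have -> : (i%:Z == (size w)%:Z) = (i == size w) by [].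
have [i_w|w_i|->] := ltngtP i (size w); first by rewrite mulg1.
  by rewrite mulg1 nth_default // ltnW.
by rewrite nth_default // mul1g.
Qed.

Lemma word_length_walk s w :
  (word_length (walk s w) <= size w + count (fun c => c != 1%g) w)%N.
Proof.
elim: w => [|c w IHw]; first by rewrite /walk big_nil word_length1.
rewrite /walk big_cons; apply: leq_trans (word_lengthM _ _) _.
rewrite -/(walk s w) /=; have := word_lengthM (lamp c) (step s).
by have := word_length_lamp c; have := word_length_step s; lia.
Qed.

(** Here [k] is the amount of backtracking, and the [a] idle steps pad the sweep so that the
    endpoint can be prescribed independently of the size of [w]. *)
Definition detour s w (a k : nat) : lamplighter F :=
  (walk s w * (step s ^+ a * step (~~ s) ^+ k))%g.

Lemma cursor_detour s w a k :
  cursor (detour s w a k) = (-1) ^+ s * ((size w + a)%:Z - k%:Z).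
Proof.
rewrite /detour !cursorM !cursorX cursor_walk !cursor_step PoszD.
by case: s; rewrite /= ?expr0 ?expr1; ring.
Qed.

Lemma word_length_detour s w a k :
  (word_length (detour s w a k)
     <= size w + a + k + count (fun c => c != 1%g) w)%N.
Proof.
have stepX t b : (word_length (step t ^+ b)%g <= b)%N.
  rewrite -[leqRHS]muln1; apply: leq_trans (word_lengthX _ _) _.
  by rewrite leq_mul2l word_length_step orbT.
apply: leq_trans (word_lengthM _ _) _.
apply: leq_trans (leq_add (word_length_walk _ _) (word_lengthM _ _)) _.
apply: leq_trans (leq_add (leqnn _) (leq_add (stepX _ _) (stepX _ _))) _.
lia.
Qed.

(** The idle tail touches no lamp, so the final configuration still spells [w]. *)
Lemma detour_inj s a k w w' : size w = size w' ->
  detour s w a k = detour s w' a k -> w = w'.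
Proof.
move=> ww' eq_w; apply: (@eq_from_nth _ 1%g) => // i _.
rewrite -!(lamps_walk s).
have lampsE v j : lamps (detour s v a k) j = lamps (walk s v) j.
  apply: lampsM_shift => l; rewrite lampsM_shift => [|l']; exact: lamps_stepX.
by rewrite -!lampsE eq_w.
Qed.

End Walks.

(** * Configurations with a given number of lamps *)

Section Counting.

(** The weight is a product over sites, so sum and product may be exchanged. A general ring allows
    both a real weight and the indeterminate ['X]. *)
Lemma sum_lamp_weight (A : comNzRingType) (F : finGroupType) (r K : nat) (q : A) :
  #|F| = r.+1 ->
  \sum_(f : {ffun 'I_K -> F}) q ^+ #|[pred i | f i != 1%g]| = (q *+ r + 1) ^+ K.
Proof.
move=> hF; pose w (c : F) := if c == 1%g then 1 else q.
have wE (f : {ffun 'I_K -> F}) : \prod_i w (f i) = q ^+ #|[pred i | f i != 1%g]|.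
  rewrite (bigID (fun i => f i == 1%g)) /= big1 => [|i fi]; last by rewrite /w fi.
  rewrite mul1r (eq_bigr (fun=> q)) => [|i /negPf fi]; last by rewrite /w fi.
  by rewrite prodr_const.
have sum_w : \sum_c w c = q *+ r + 1.
  rewrite (bigD1 1%g) //= {1}/w eqxx addrC; congr (_ + _).
  rewrite (eq_bigr (fun=> q)) => [|c /negPf c1]; last by rewrite /w c1.
  by rewrite sumr_const; congr (_ *+ _); have := cardC1 (1%g : F); rewrite hF.
rewrite -[K in RHS]card_ord -sum_w -prodr_const bigA_distr_bigA.
by apply: eq_bigr => f _; rewrite wE.
Qed.

(** Compare the coefficients of ['X ^+ m] in the generating polynomial [('X *+ r + 1) ^+ K]. *)
Lemma card_lamp_count (F : finGroupType) (r : nat) (K m : nat) : #|F| = r.+1 ->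
  #|[pred f : {ffun 'I_K -> F} | #|[pred i | f i != 1%g]| == m]| = ('C(K, m) * r ^ m)%N.
Proof.
move=> hF; have := sum_lamp_weight K ('X : {poly int}) hF; rewrite exprD1n => /esym.
move/(congr1 (fun p : {poly int} => p`_m)); rewrite !coef_sum.
rewrite (eq_bigr (fun i : 'I_K.+1 =>
    (if m == i then 'C(K, m) * r ^ m else 0)%N%:R : int)); last first.
  move=> i _; rewrite exprMn_n !coefMn coefXn -mulrnA.
  by case: eqVneq => [<-|_]; rewrite ?mul0rn // mulnC.
rewrite -natr_sum [in RHS](eq_bigr (fun f : {ffun 'I_K -> F} =>
    (if #|[pred i | f i != 1%g]| == m then 1 else 0)%N%:R : int)); last first.
  by move=> f _; rewrite coefXn eq_sym; case: eqP.
rewrite -natr_sum => /eqP; rewrite eqr_nat => /eqP.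
rewrite -!big_mkcond /= => E; rewrite -sum1_card; apply: etrans (esym E) _ => {E}.
have [le_mK|lt_Km] := leqP m K; first 
  rewrite (big_pred1 (inord m)) // => i /=.
  by rewrite -[RHS](inj_eq val_inj) /= inordK // eq_sym.
by rewrite bin_small // mul0n big1 // => i /eqP.
Qed.

(** Each configuration on [K] sites yields a distinct detour towards [j] with backtracking [k]. The
    padding [a] makes the sweep [|j| + k] long, so the word has length at most [m + |j| + 2 k]. *)
Lemma cursor_count_ge (F : finGroupType) (r : nat) (K k m n : nat) (j : int) :
  #|F| = r.+1 -> (K <= `|j| + k)%N -> (m + `|j| + 2 * k <= n)%N ->
  ('C(K, m) * r ^ m <= cursor_count F j n)%N.
Proof.
move=> hF le_K le_n; rewrite -(card_lamp_count _ _ hF) /cursor_count.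
set D := [pred f | _]; pose a := (`|j| + k - K)%N.
pose h (f : {ffun 'I_K -> F}) := detour (j < 0) (codom f) a k.
have szw (f : {ffun 'I_K -> F}) : size (codom f) = K by rewrite size_codom card_ord.
have h_inj : injective h.
  move=> f g; rewrite /h => /detour_inj; rewrite !szw => /(_ erefl) eq_fg.
  apply/ffunP => i; move: eq_fg; rewrite !codomE => /eq_in_map; apply.
  by rewrite mem_enum.
apply: (@leq_trans #|` [fset h f | f in D]%fset|).
  by rewrite card_imfset //= -cardE.
apply/fsubset_leq_card/fsubsetP => x /imfsetP [f /=]; rewrite inE => /eqP fm ->.
rewrite in_fset_set; last first.
  by apply: sub_finite_set (finite_lamp_ball F n) => y [].
rewrite inE; split; last first.
  by rewrite cursor_detour szw /a; case: ltrP => j0; rewrite ?expr0 ?expr1; lia.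
apply: leq_trans (word_length_detour _ _ _ _) _.
have -> : count (fun c => c != 1%g) (codom f) = m.
  rewrite count_map -fm cardE -size_filter; congr (size _).
  by rewrite enumT; apply: eq_filter.
by rewrite szw /a; lia.
Qed.

End Counting.

(** * Counting by exponential weights *)

Section MasterCount.
Variable F : finGroupType.
Implicit Types (x y : lamplighter F).

Definition hull_size x : nat := `|hull_length x|%N.

Lemma hull_sizeE x : hull_length x = (hull_size x)%:Z.
Proof.
have := hull_min_le x; have := hull_max_ge x.
by rewrite /hull_size /hull_length; lia.
Qed.

Lemma cursor_hull x : (`|cursor x| <= hull_size x)%N.
Proof.
have := hull_min_le x; have := hull_max_ge x; have := hull_sizeE x.
by rewrite /hull_length; lia.
Qed.

Lemma hull_min_size x : (`|hull_min x| <= hull_size x)%N.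
Proof.
have := hull_min_le x; have := hull_max_ge x; have := hull_sizeE x.
by rewrite /hull_length; lia.
Qed.

Lemma lamp_ball_le n x : lamp_ball n x ->
  (lamp_count x + 2 * hull_size x <= n + `|cursor x|)%N.
Proof.
rewrite /lamp_ball /=; have := word_length_ge x; have := hull_sizeE x.
by move: (hull_size x) (hull_length x) (cursor x); lia.
Qed.

Lemma lamp_ball_cursor n x : lamp_ball n x -> (`|cursor x| <= n)%N.
Proof. by move=> /lamp_ball_le; have := cursor_hull x; lia. Qed.

Lemma lamp_hull_le n x : lamp_ball n x -> (lamp_count x + hull_size x <= n)%N.
Proof. by move=> /lamp_ball_le; have := cursor_hull x; lia. Qed.

Definition hull_lamps x K : {ffun 'I_K -> F} :=
  [ffun i : 'I_K => lamps x (hull_min x + (i : nat)%:Z)].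

(** Lamps are off outside the hull, so the window of [hull_size + 1] sites starting at [hull_min]
    determines the configuration. *)
Lemma hull_lampsK x y K : hull_min x = hull_min y -> cursor x = cursor y ->
  K = (hull_size x).+1 -> K = (hull_size y).+1 ->
  hull_lamps x K = hull_lamps y K -> x = y.
Proof.
move=> eq_min eq_cur Kx Ky /ffunP eq_l; apply: lamp_eqP => // i.
have hullE z : lamps z i != 1%g -> hull_min z <= i < hull_min z + (hull_size z).+1%:Z.
  by move=> /lamps_hull; have := hull_sizeE z; rewrite /hull_length; lia.
have [iI|iI] := boolP (hull_min x <= i < hull_min x + K%:Z).
  have iK : (`|i - hull_min x| < K)%N by lia.
  have := eq_l (Ordinal iK); rewrite !ffunE /= -eq_min.
  by have -> : hull_min x + `|i - hull_min x|%N = i by lia.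
have z1 z : hull_min z = hull_min x -> K = (hull_size z).+1 -> lamps z i = 1%g.
  by move=> eq_z Kz; apply/eqP; apply: contraNT iI => /hullE; rewrite eq_z -Kz.
by rewrite !z1.
Qed.

Lemma hull_lamps_count x K : K = (hull_size x).+1 ->
  #|[pred i | hull_lamps x K i != 1%g]| = lamp_count x.
Proof.
move=> ->; rewrite /lamp_count cardE.
rewrite -(size_map (fun i : 'I_(hull_size x).+1 => hull_min x + (i : nat)%:Z)).
apply/perm_size/uniq_perm; rewrite ?fset_uniq //.
  rewrite map_inj_uniq ?enum_uniq // => i j /addrI [] ij; exact: val_inj.
move=> i; rewrite mem_lamps; apply/mapP/idP => [[k]|].
  by rewrite mem_enum inE /= ffunE => kl ->.
move=> il; have := lamps_hull il; have := hull_sizeE x; rewrite /hull_length => hE iI.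
have iK : (`|i - hull_min x| < (hull_size x).+1)%N by lia.
have iE : i = hull_min x + `|i - hull_min x|%N by lia.
by exists (Ordinal iK); rewrite // mem_enum inE /= ffunE /= -iE.
Qed.

Lemma ler_sum_inj (R : numDomainType) (I : finType) (T : eqType) (s : seq T)
    (h : T -> I) (G : I -> R) :
  uniq s -> {in s &, injective h} -> (forall i, 0 <= G i) ->
  \sum_(x <- s) G (h x) <= \sum_i G i.
Proof.
move=> us h_inj G0; rewrite -(big_map h xpredT G) big_uniq ?map_inj_in_uniq //=.
by rewrite big_mkcond; apply: ler_sum => i _; case: ifP.
Qed.

Variables (R : realFieldType) (r : nat).
Hypothesis hF : #|F| = r.+1.

(** By [hull_lampsK] the class injects into the configurations on [l.+1] sites, whose total weight
    is known. *)
Lemma hull_class_weight (s : seq (lamplighter F)) (q : R) (a j : int) l :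
  0 <= q -> uniq s ->
  (forall x, x \in s -> [/\ hull_min x = a, cursor x = j & hull_size x = l]) ->
  \sum_(x <- s) q ^+ lamp_count x <= (1 + r%:R * q) ^+ l.+1.
Proof.
move=> q0 us sP.
pose G (f : {ffun 'I_l.+1 -> F}) := q ^+ #|[pred i | f i != 1%g]|.
rewrite big_seq (eq_bigr (fun x => G (hull_lamps x l.+1))); last first.
  by move=> x /sP [_ _ xl]; rewrite /G hull_lamps_count // xl.
rewrite -big_seq; apply: le_trans (ler_sum_inj us _ _) _.
- move=> x y /sP [xa xj xl] /sP [ya yj yl]; apply: hull_lampsK; by rewrite ?xa ?ya ?xj ?yj ?xl ?yl.
- by move=> f; rewrite /G exprn_ge0.
by rewrite (sum_lamp_weight _ _ hF) addrC mulr_natl.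
Qed.

(* Weighting each lamp by [z (cursor x)], an element of hull size [l] gets mass
   [z ^ m / (1 + r z) ^ l.+1], and every class of elements with the same hull
   and cursor has total mass at most 1; it remains to count the classes. *)
Lemma lamp_count_bound (z : int -> R) (E : R) n (X : set (lamplighter F)) :
  X `<=` lamp_ball n -> 0 <= E ->
  (forall x, X x -> 0 <= z (cursor x)) ->
  (forall x, X x -> (1 + r%:R * z (cursor x)) ^+ (hull_size x).+1
                    <= E * z (cursor x) ^+ lamp_count x) ->
  (#|` fset_set X|)%:R <= E * (2 * n + 1)%:R * n.+1%:R ^+ 2.
Proof.
move=> Xn E0 z0 XE.
have finX : finite_set X by apply: sub_finite_set (finite_lamp_ball F n).
have memX x : (x \in fset_set X) = (x \in X) by rewrite in_fset_set.
pose D x : R := (1 + r%:R * z (cursor x)) ^+ (hull_size x).+1.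
have D0 x : X x -> 0 < D x.
  by move=> Xx; rewrite exprn_gt0 // ltr_pwDl // mulr_ge0 // z0.
have sizes x : X x -> [/\ (`|cursor x| <= n)%N, (`|hull_min x| <= n)%N & (hull_size x <= n)%N].
  move=> /Xn /lamp_ball_le; have := cursor_hull x; have := hull_min_size x.
  by move=> *; split; lia.
(* A class is given by cursor, left end and size of the hull. The cursor is shifted by [n] to become
   a natural number; the absolute value of [hull_min] suffices because [hull_min] is never
   positive. *)
pose I : finType := ('I_(2 * n).+1 * ('I_n.+1 * 'I_n.+1))%type.
pose key x : I := (inord (absz (cursor x + n%:Z)%R), (inord `|hull_min x|%N, inord (hull_size x))).
have keyE x y : X x -> X y -> key x = key y ->
    [/\ hull_min x = hull_min y, cursor x = cursor y & hull_size x = hull_size y].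
  move=> /sizes [cx mx lx] /sizes [cy my ly] [].
  move=> /(congr1 val) /= + /(congr1 val) /= + /(congr1 val) /=.
  rewrite !inordK //; try lia.
  have := hull_min_le x; have := hull_min_le y.
  by move=> *; split; lia.
(* By hypothesis every summand is at least 1, so the sum dominates the cardinality. *)
apply: (@le_trans _ _ (\sum_(x <- fset_set X) E * (z (cursor x) ^+ lamp_count x / D x))).
  rewrite -sum1_size natr_sum [leLHS]big_seq [leRHS]big_seq; apply: ler_sum => x.
  by rewrite memX => /set_mem xX; rewrite mulrA ler_pdivlMr ?D0 // mul1r; exact: XE.
rewrite -mulr_sumr -mulrA ler_wpM2l //.
rewrite (partition_big key xpredT) //=.
have <- : (#|I|%:R : R) = (2 * n + 1)%:R * n.+1%:R ^+ 2.
  by rewrite !card_prod !card_ord !natrM expr2 addn1.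
rewrite -sum1_card natr_sum; apply: ler_sum => i _.
rewrite -big_filter; set s := seq.filter _ _.
have [->|[y ys]] : s = [::] \/ exists y, y \in s.
    by case: s => [|y s]; [left|right; exists y; rewrite mem_head].
  by rewrite big_nil.
have sP x : x \in s -> X x /\ key x = i.
  by rewrite mem_filter => /andP[/eqP xi]; rewrite memX => /set_mem.
have [yX yi] := sP _ ys.
have sy x : x \in s ->
    [/\ hull_min x = hull_min y, cursor x = cursor y & hull_size x = hull_size y].
  by move=> /sP [xX xi]; apply: keyE => //; rewrite xi.
rewrite big_seq (eq_bigr (fun x => (D y)^-1 * z (cursor y) ^+ lamp_count x)); last first.
  by move=> x /sy [_ xj xl]; rewrite /D xj xl mulrC.
rewrite -big_seq -mulr_sumr mulrC ler_pdivrMr ?D0 // mul1r.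
by apply: hull_class_weight sy; rewrite ?filter_uniq ?fset_uniq ?z0.
Qed.

End MasterCount.

(** * Exponents *)

Section BinomialMode.
Variable R : realFieldType.

(* [m] maximises [i |-> 'C(K, i) * q ^ i]; comparing it with its two neighbours
   locates it next to the mean [K * q / (1 + q)]. *)
Lemma binom_mode (q : R) K : 0 <= q ->
  exists m, [/\ (m <= K)%N, m%:R * (1 + q) <= K.+1%:R * q,
    K.+1%:R * q <= m.+1%:R * (1 + q) &
    (1 + q) ^+ K <= K.+1%:R * ('C(K, m)%:R * q ^+ m)].
Proof.
move=> q0; pose t i : R := 'C(K, i)%:R * q ^+ i.
have t0 i : 0 <= t i by rewrite mulr_ge0 ?exprn_ge0.
(* The ratio of consecutive terms is [(K - i) q / (i + 1)]; bounding it at the maximiser on either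
   side gives the two localisation inequalities. *)
have tS i : i.+1%:R * t i.+1 = (K%:R - i%:R) * q * t i.
  have [le_iK|lt_Ki] := leqP i K; last by rewrite /t !bin_small ?mul0r ?mulr0 // ltnW.
  have := mul_bin_left K i => /(congr1 (fun k => k%:R : R)).
  by rewrite !natrM natrB // /t exprS => E; rewrite mulrA E; ring.
have sum_t : (1 + q) ^+ K = \sum_(i < K.+1) t i.
  by rewrite addrC exprD1n; apply: eq_bigr => i _; rewrite /t mulr_natl.
pose m := [arg max_(i > ord0 : 'I_K.+1) t i]%O.
have tm (i : 'I_K.+1) : t i <= t m by rewrite /m; case: arg_maxP => // k _; apply.
have le_mK : (m <= K)%N by rewrite -ltnS.
have le_t i : t i <= t m.
  have [le_iK|lt_Ki] := leqP i K; last by rewrite {1}/t bin_small ?mul0r.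
  by have := tm (Ordinal (le_iK : (i < K.+1)%N)).
have tm0 : 0 < t m.
  rewrite lt_def t0 andbT; apply/eqP => tm0.
  by have := le_t 0%N; rewrite tm0 /t bin0 expr0 mulr1 ler10.
exists m; split => //.
- case: (m : nat) (tm0) (le_t) => [|k] tk0 le_tk; first by rewrite mul0r mulr_ge0.
  have := tS k; have := le_tk k; rewrite -!natr1 => le_k E.
  have [lt_Kk|le_kK] := ltP (K%:R : R) k%:R.
    have [le_kK|lt_kK] := leqP k K; first by move: lt_Kk; rewrite ltNge ler_nat le_kK.
    by move: tk0; rewrite /t bin_small ?mul0r ?ltxx // ltnW.
  have : (k%:R + 1) * t k.+1 <= (K%:R - k%:R) * q * t k.+1.
    by rewrite E ler_wpM2l // mulr_ge0 // subr_ge0.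
  by rewrite ler_pM2r // => ?; lra.
- have := tS m; have := le_t m.+1; rewrite -!natr1 => le_m E.
  have : (K%:R - m%:R) * q * t m <= (m%:R + 1) * t m.
    by rewrite -E ler_wpM2l // natr1.
  by rewrite ler_pM2r // => ?; lra.
- rewrite sum_t; apply: (@le_trans _ _ (\sum_(i < K.+1) t m)); first exact: ler_sum.
  by rewrite sumr_const card_ord mulr_natl.
Qed.

End BinomialMode.

(** * The Chernoff exponent and its minimiser *)

Section Exponent.
Variables (R : realType) (r : nat).
Hypothesis r0 : (0 < r)%N.

(* Chernoff exponent: for every [z > 0] at most [expR (tilted t s z)]
   configurations on [s] sites have [t - s] lamps. *)
Definition tilted (t s z : R) : R := s * ln (1 + r%:R * z) - (t - s) * ln z.

Lemma tilted_scale (t b z : R) : tilted t (b * t) z = t * tilted 1 b z.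
Proof. by rewrite /tilted; ring. Qed.

Lemma base_gt0 (z : R) : 0 <= z -> 0 < 1 + r%:R * z.
Proof. by move=> z0; apply: ltr_pwDl => //; exact: mulr_ge0. Qed.

(* The minimiser of [tilted 1 b] over [z > 0], for [1 / 2 < b < 1]. *)
Definition opt_tilt (b : R) : R := (1 - b) / (r%:R * (2 * b - 1)).

Let rR : 0 < r%:R :> R. Proof. by rewrite ltr0n. Qed.

Lemma opt_tilt_gt0 b : 1 / 2 < b < 1 -> 0 < opt_tilt b.
Proof. by move=> b1; rewrite divr_gt0 ?mulr_gt0 //; lra. Qed.

Lemma opt_tilt_le b b' : 1 / 2 < b -> b <= b' -> b' <= 1 -> opt_tilt b' <= opt_tilt b.
Proof.
move=> b2 bb b1; have b0 : 0 < 2 * b - 1 by lra.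
have b'0 : 0 < 2 * b' - 1 by lra.
rewrite /opt_tilt ler_pdivrMr ?mulr_gt0 // mulrAC ler_pdivlMr ?mulr_gt0 //.
by rewrite [leLHS]mulrCA [leRHS]mulrCA ler_pM2l //; nra.
Qed.

Lemma lt_ln_sub1 (x : R) : 0 < x -> x != 1 -> ln x < x - 1.
Proof.
move=> x0 x1; have : ln x != 0 by rewrite ln_eq0.
by move/expR_gt1Dx; rewrite lnK // => ?; lra.
Qed.

(* Gibbs' inequality for the Bernoulli laws of lamp density [r z / (1 + r z)]. *)
Lemma tilted_opt_lt b z : 1 / 2 < b < 1 -> 0 < z -> z != opt_tilt b ->
  tilted 1 b (opt_tilt b) < tilted 1 b z.
Proof.
move=> b1 z0 zw; set w := opt_tilt b in zw *.
have w0 : 0 < w by exact: opt_tilt_gt0.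
have wz : 0 < 1 + r%:R * z by exact/base_gt0/ltW.
have ww : 0 < 1 + r%:R * w by exact/base_gt0/ltW.
have rw : r%:R * w * (2 * b - 1) = 1 - b.
  have b0 : 0 < 2 * b - 1 by lra.
  have -> : r%:R * w * (2 * b - 1) = w * (r%:R * (2 * b - 1)) by ring.
  by rewrite /w /opt_tilt divfK // mulf_neq0 // gt_eqF.
(* Likelihood ratios of a dark site ([x]) and of a lit site ([y]) between the tilts [z] and [w].
   Under [w] dark and lit have odds [2 b - 1] to [1 - b] by [rw], so [x - 1] and [y - 1] average to
   zero. *)
pose x := (1 + r%:R * w) / (1 + r%:R * z); pose y := x * (z / w).
have x0 : 0 < x by rewrite divr_gt0.
have zw0 : 0 < z / w by exact: divr_gt0.
have y0 : 0 < y by exact: mulr_gt0.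
have lnx : ln x = ln (1 + r%:R * w) - ln (1 + r%:R * z) by rewrite ln_div.
have lny : ln y = ln x + (ln z - ln w).
  by rewrite /y lnM ?posrE // [ln (z / w)]ln_div ?posrE.
have -> : tilted 1 b w = tilted 1 b z + ((2 * b - 1) * ln x + (1 - b) * ln y).
  by rewrite /tilted lny lnx; ring.
rewrite gtrDl.
have x1 : x != 1.
  apply: contra zw => /eqP x1; apply/eqP.
  by have /addrI/mulfI -> // := divr1_eq x1; rewrite gt_eqF.
have hx : (2 * b - 1) * ln x < (2 * b - 1) * (x - 1).
  by rewrite ltr_pM2l ?lt_ln_sub1 //; lra.
have hy : (1 - b) * ln y <= (1 - b) * (y - 1).
  rewrite ler_pM2l; last by lra.
  have := @le_ln1Dx R (y - 1); rewrite (addrC 1) subrK; apply; lra.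
suff : (2 * b - 1) * (x - 1) + (1 - b) * (y - 1) = 0 by lra.
rewrite -rw /y /x; field; rewrite !gt_eqF //.
Qed.

Lemma tilted_weight (z e : R) (k m : nat) : 0 < z ->
  k%:R * ln (1 + r%:R * z) - m%:R * ln z <= e ->
  (1 + r%:R * z) ^+ k <= expR e * z ^+ m.
Proof.
move=> z0 le_e; have wz : 0 < 1 + r%:R * z by exact/base_gt0/ltW.
rewrite -[in leLHS](lnK wz) -[in leRHS](lnK z0) -!expRM_natl -expRD ler_expR.
lra.
Qed.

End Exponent.

(** * The critical densities and the rate *)

Section Rate.
Variables (R : realType) (r : nat) (rho omega : R).
Hypotheses (r0 : (0 < r)%N) (rho1 : 1 < rho) (rhoE : rho ^+ 3 = rho + r%:R)
  (omega1 : 1 < omega) (omegaE : omega ^+ 2 = omega + r%:R).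

Definition beta_star : R := (1 + r%:R / (r%:R + rho))^-1.
Definition beta_bar : R := omega ^+ 2 / (omega ^+ 2 + r%:R).

Let rR : 0 < r%:R :> R. Proof. by rewrite ltr0n. Qed.

Let pos : 0 < r%:R :> R /\ 1 < rho.
Proof. by rewrite rR rho1. Qed.

Let omega_gt1 : 1 < omega.
Proof. by []. Qed.

(** The map [t ^+ 3 - t] increases for [t >= 1]; it equals [r] at [rho] and [r (1 + omega)] at
    [omega]. *)
Lemma rho_lt_omega : rho < omega.
Proof.
have [rR0 rhoG] := pos; have omegaG := omega_gt1.
rewrite ltNge; apply/negP => le_or.
have : omega ^+ 3 - omega <= rho ^+ 3 - rho.
  rewrite -subr_ge0.
  have -> : rho ^+ 3 - rho - (omega ^+ 3 - omega) =
     (rho - omega) * (rho ^+ 2 + rho * omega + omega ^+ 2 - 1) by ring.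
  have h1 : 0 <= (rho - 1) * (rho + 1) by apply: mulr_ge0; lra.
  have h2 : 0 <= rho * omega by apply: mulr_ge0; lra.
  have h3 : 0 <= omega ^+ 2 by exact: sqr_ge0.
  by apply: mulr_ge0; lra.
have -> : omega ^+ 3 = omega * omega ^+ 2 by rewrite exprS.
have h : 0 < r%:R * (omega - 1) by apply: mulr_gt0; lra.
have -> : omega * omega ^+ 2 = omega + r%:R + r%:R * omega.
  by rewrite omegaE mulrDr -expr2 omegaE; ring.
by rewrite rhoE; lra.
Qed.

Lemma beta_starE : beta_star = (r%:R + rho) / (2 * r%:R + rho).
Proof.
have [rR0 rhoG] := pos.
by rewrite /beta_star; field; rewrite !gt_eqF //; lra. Qed.

Lemma beta_barE : beta_bar = (omega + r%:R) / (omega + 2 * r%:R).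
Proof.
have rR0 := rR; have omegaG := omega_gt1.
by rewrite /beta_bar omegaE; field; rewrite !gt_eqF //; lra. Qed.

Lemma beta_star_half : 1 / 2 < beta_star.
Proof.
have [rR0 rhoG] := pos.
by rewrite beta_starE ltr_pdivlMr; lra. Qed.

Lemma beta_star_lt1 : beta_star < 1.
Proof.
have [rR0 rhoG] := pos.
by rewrite beta_starE ltr_pdivrMr; lra. Qed.

Lemma beta_bar_lt1 : beta_bar < 1.
Proof.
have rR0 := rR; have omegaG := omega_gt1.
by rewrite beta_barE ltr_pdivrMr; lra. Qed.

Lemma beta_star_lt_bar : beta_star < beta_bar.
Proof.
have [rR0 rhoG] := pos; have omegaG := omega_gt1.
have rw := rho_lt_omega.
have h : 0 < r%:R * (omega - rho) by apply: mulr_gt0; lra.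
have d1 : 0 < 2 * r%:R + rho by lra.
have d2 : 0 < omega + 2 * r%:R by lra.
rewrite beta_starE beta_barE ltr_pdivrMr // mulrAC ltr_pdivlMr //; lra.
Qed.

(** This singles out [beta_star]: the free minimiser meets the cap there, so the two branches of
    [tilt] agree. *)
Lemma opt_tilt_star : opt_tilt r beta_star = rho^-1.
Proof.
have [rR0 rhoG] := pos.
have rhorho : r%:R + rho != 0 by rewrite gt_eqF //; lra.
rewrite /opt_tilt beta_starE; field; rewrite !gt_eqF //; lra.
Qed.

Lemma opt_tilt_bar : opt_tilt r beta_bar = omega^-1.
Proof.
have rR0 := rR; have omegaG := omega_gt1.
by rewrite /opt_tilt beta_barE; field; rewrite !gt_eqF //; lra. Qed.

Lemma rho_base : 1 + r%:R * rho^-1 = rho ^+ 2.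
Proof.
have [rR0 rhoG] := pos.
have rho0 : rho != 0 by rewrite gt_eqF //; lra.
apply: (mulIf rho0); rewrite mulrDl divfK // mul1r -rhoE; ring.
Qed.

Lemma omega_base : 1 + r%:R * omega^-1 = omega.
Proof.
have rR0 := rR; have omegaG := omega_gt1.
have omega0 : omega != 0 by rewrite gt_eqF //; lra.
by apply: (mulIf omega0); rewrite mulrDl divfK // mul1r -omegaE expr2.
Qed.

(* The optimal tilt is capped at [rho^-1], where [z ^ 2 * (1 + r * z) = 1]:
   beyond it, lengthening the hull by backtracking would increase the count. *)
Definition tilt (b : R) : R :=
  if `|b| <= beta_star then rho^-1 else opt_tilt r `|b|.

(** Closed form of the directional growth spectrum on [[-1, 1]]. *)
Definition rate (b : R) : R := tilted r 1 `|b| (tilt b).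

Lemma tilt_opt b : beta_star <= `|b| -> tilt b = opt_tilt r `|b|.
Proof.
rewrite /tilt; case: ifP => // le_b ge_b.
have -> : `|b| = beta_star by apply/le_anti; rewrite le_b.
by rewrite opt_tilt_star.
Qed.

Lemma tilt_le b : `|b| <= 1 -> tilt b <= rho^-1.
Proof.
move=> b1; rewrite /tilt; case: (lerP `|b| beta_star) => // lt_b.
by rewrite -opt_tilt_star opt_tilt_le // ?beta_star_half // ltW.
Qed.

Lemma rhoV_gt0 : 0 < rho^-1.
Proof.
have [rR0 rhoG] := pos.
by rewrite invr_gt0; lra. Qed.

Lemma tilt_gt0 b : `|b| < 1 -> 0 < tilt b.
Proof.
have [rR0 rhoG] := pos.
move=> b1; rewrite /tilt; case: (lerP `|b| beta_star) => [_|lt_b]; first exact: rhoV_gt0.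
by apply: opt_tilt_gt0 => //; have := beta_star_half; lra.
Qed.

Lemma tilt1 b : `|b| = 1 -> tilt b = 0.
Proof.
move=> b1; rewrite tilt_opt b1; first by rewrite /opt_tilt subrr mul0r.
by apply/ltW; exact: beta_star_lt1.
Qed.

Lemma rateN b : rate (- b) = rate b.
Proof. by rewrite /rate /tilt normrN. Qed.

(** The tilt is 0 here, and the factor [1 - |b|] kills the term with [ln 0], whatever its default
    value. *)
Lemma rate1 b : `|b| = 1 -> rate b = 0.
Proof.
by move=> b1; rewrite /rate tilt1 // /tilted b1 mulr0 addr0 ln1 subrr mul0r mulr0 subr0.
Qed.

Lemma rate_star b : `|b| <= beta_star -> rate b = (1 + `|b|) * ln rho.
Proof.
have [rR0 rhoG] := pos.
move=> le_b; rewrite /rate /tilt le_b /tilted rho_base.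
by rewrite lnXn ?lnV ?posrE; try lra; ring.
Qed.

(** At [omega^-1] a hull site and a lamp both contribute [ln omega], so only their total [t]
    counts. *)
Lemma tilted_omega (t s : R) : tilted r t s omega^-1 = t * ln omega.
Proof.
have rR0 := rR; have omegaG := omega_gt1.
by rewrite /tilted omega_base lnV ?posrE; try lra; ring.
Qed.

Lemma rate_bar : rate beta_bar = ln omega.
Proof.
have [rR0 rhoG] := pos; have omegaG := omega_gt1.
have bar0 : 0 < beta_bar by have := beta_star_half; have := beta_star_lt_bar; lra.
rewrite /rate tilt_opt ?(gtr0_norm bar0) ?opt_tilt_bar ?tilted_omega ?mul1r //.
exact/ltW/beta_star_lt_bar.
Qed.

Lemma opt_tilt_inj (b b' : R) : 1 / 2 < b -> 1 / 2 < b' ->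
  opt_tilt r b = opt_tilt r b' -> b = b'.
Proof.
have [rR0 rhoG] := pos.
move=> b2 b'2.
have nz (v : R) : 1 / 2 < v -> r%:R * (2 * v - 1) != 0.
  by move=> v2; rewrite mulf_neq0 // gt_eqF //; lra.
move/eqP; rewrite /opt_tilt eqr_div ?nz //.
move=> /eqP; have -> : (1 - b) * (r%:R * (2 * b' - 1)) = r%:R * ((1 - b) * (2 * b' - 1)) by ring.
have -> : (1 - b') * (r%:R * (2 * b - 1)) = r%:R * ((1 - b') * (2 * b - 1)) by ring.
have rn0 : r%:R != 0 :> R by rewrite gt_eqF.
by move/(mulfI rn0) => ?; lra.
Qed.

Lemma tilted_opt_lt_omega b : 1 / 2 < b < 1 -> b != beta_bar ->
  tilted r 1 b (opt_tilt r b) < ln omega.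
Proof.
have [rR0 rhoG] := pos; have omegaG := omega_gt1.
move=> b1 bbar; rewrite -[ltRHS]mul1r -(tilted_omega 1 b).
apply: tilted_opt_lt => //; first by rewrite invr_gt0; lra.
rewrite -opt_tilt_bar eq_sym; apply: contra bbar => /eqP /opt_tilt_inj -> //.
  by lra.
by have := beta_star_half; have := beta_star_lt_bar; lra.
Qed.

(** Up to [beta_star] the rate increases with [|b|], which reduces to [beta_star] itself; from there
    on Gibbs' inequality is strict away from [beta_bar], and at [|b| = 1] the rate is 0. *)
Lemma rate_lt b : `|b| <= 1 -> `|b| != beta_bar -> rate b < ln omega.
Proof.
have [rR0 rhoG] := pos; have omegaG := omega_gt1.
move=> b1 bbar; have half := beta_star_half; have lt1 := beta_star_lt1.
have [le_b|lt_b] := lerP `|b| beta_star.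
  have star0 : `|beta_star| = beta_star by rewrite gtr0_norm; lra.
  apply: (@le_lt_trans _ _ (rate beta_star)).
    rewrite !rate_star ?star0 // ler_wpM2r ?lerD2l //.
    by apply: ln_ge0; lra.
  rewrite /rate tilt_opt star0 // tilted_opt_lt_omega //; first by lra.
  by rewrite lt_eqF // beta_star_lt_bar.
have [b1'|b1'] := ltrP `|b| 1.
  rewrite /rate tilt_opt ?(ltW lt_b) // tilted_opt_lt_omega //; lra.
rewrite rate1; last by lra.
exact: ln_gt0.
Qed.

Lemma rate_le b : `|b| <= 1 -> rate b <= ln omega.
Proof.
have [rR0 rhoG] := pos; have omegaG := omega_gt1.
move=> b1; have [bbar|bbar] := eqVneq `|b| beta_bar; last exact/ltW/rate_lt.
rewrite /rate tilt_opt bbar; first by rewrite opt_tilt_bar tilted_omega mul1r.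
exact/ltW/beta_star_lt_bar.
Qed.

(** [z ^+ 2 * (1 + r * z)] increases with [z] and equals 1 at [rho^-1]. It is the net effect of one
    more hull site at a fixed cursor: a factor [1 + r z] against two units of length. *)
Lemma ln_base_le z : 0 < z -> z <= rho^-1 -> ln (1 + r%:R * z) + 2 * ln z <= 0.
Proof.
have [rR0 rhoG] := pos.
move=> z0 le_z; have := rhoV_gt0 => rho0.
have -> : 0 = ln (1 + r%:R * rho^-1) + 2 * ln rho^-1 :> R.
  by rewrite rho_base lnXn ?lnV ?posrE; try lra; ring.
apply: lerD; first rewrite ler_ln ?posrE ?base_gt0 ?lerD2l ?ler_wpM2l //; try exact: ltW.
by rewrite ler_wpM2l // ler_ln ?posrE.
Qed.

Lemma ln_base_rho : ln (1 + r%:R * rho^-1) + 2 * ln rho^-1 = 0.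
Proof.
have [rR0 rhoG] := pos.
by rewrite rho_base lnXn ?lnV ?posrE; try lra; ring. Qed.

(* [kappa] is the backtracking density at the optimum: it is 0 above [beta_star],
   and below it makes the lamp density on the hull equal to its tilted mean. *)
Lemma tilt_kappa b : `|b| < 1 -> exists kappa : R, [/\ 0 <= kappa,
  (1 - `|b| - 2 * kappa) * (1 + r%:R * tilt b) = r%:R * tilt b * (`|b| + kappa),
  0 < `|b| + kappa &
  kappa * (ln (1 + r%:R * tilt b) + 2 * ln (tilt b)) = 0].
Proof.
have [rR0 rhoG] := pos.
move=> b1; have b0 : 0 <= `|b| by [].
have half := beta_star_half; have [le_b|lt_b] := lerP `|b| beta_star.
  have -> : tilt b = rho^-1 by rewrite /tilt le_b.
  set q := r%:R * rho^-1; have q0 : 0 < q by rewrite mulr_gt0 // rhoV_gt0.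
  have starE : beta_star * (1 + 2 * q) = 1 + q.
    by rewrite beta_starE /q; field; rewrite !gt_eqF //; lra.
  have d0 : 0 < 2 + 3 * q by lra.
  have sum0 : `|b| + ((1 + q) - `|b| * (1 + 2 * q)) / (2 + 3 * q)
      = (1 + q) * (1 + `|b|) / (2 + 3 * q).
    by field; rewrite gt_eqF.
  (* The solution of the mean equation, which is linear in [kappa]; it is nonnegative exactly when
     [|b| <= beta_star]. *)
  exists (((1 + q) - `|b| * (1 + 2 * q)) / (2 + 3 * q)); split.
  - apply: divr_ge0; last exact: ltW.
    by rewrite subr_ge0 -starE ler_wpM2r //; lra.
  - by rewrite sum0; field; rewrite gt_eqF.
  - by rewrite sum0 divr_gt0 // mulr_gt0 //; lra.
  - by rewrite ln_base_rho mulr0.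
exists 0; rewrite mul0r mulr0 subr0 addr0 tilt_opt ?(ltW lt_b) //; split=> //; last by lra.
have d0 : 0 < 2 * `|b| - 1 by lra.
by rewrite /opt_tilt; field; rewrite !gt_eqF.
Qed.

End Rate.

(** * Polynomial factors are subexponential *)

Section Subexponential.
Variable R : realType.

(** Bound on the number of classes in the ball: cursors, times left ends, times sizes of the
    hull. *)
Definition class_bound (n : nat) : R := (2 * n + 1)%:R * n.+1%:R ^+ 2.

Lemma class_bound_ge n : n.+1%:R <= class_bound n.
Proof.
rewrite /class_bound expr2 mulrA ler_peMl //.
rewrite -natrM -[1]/(1%:R) ler_nat; nia.
Qed.

Lemma natS_subexp (d : R) : 0 < d ->
  exists C : R, forall n : nat, n.+1%:R <= expR (d * n%:R + C).
Proof.
(* From [1 + x <= expR x] at [x = d (n + 1)], divided by [d]. *)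
move=> d0; exists (d - ln d) => n.
have -> : d * n%:R + (d - ln d) = d * n.+1%:R - ln d by rewrite -natr1; ring.
rewrite expRD expRN lnK // ler_pdivlMr // mulrC.
by have := @expR_ge1Dx R (d * n.+1%:R); lra.
Qed.

Lemma class_bound_subexp (d C : R) : 0 < d ->
  \forall n \near \oo, expR C * class_bound n <= expR (d * n%:R).
Proof.
(* Three linear factors at rate [d / 6] use half of [d * n]; the other half absorbs the
   constants. *)
move=> d0; have d6 : 0 < d / 6 by lra.
have [D leD] := natS_subexp d6.
near=> n.
have le_n : 2 * (C + 1 + 3 * D) <= d * n%:R.
  rewrite [d * _]mulrC -ler_pdivrMr //; near: n; exact: nbhs_infty_ger.
have le2 : (2 : R) <= expR 1 by have := @expR_ge1Dx R 1; lra.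
have le_cb : class_bound n <= expR 1 * expR (d / 6 * n%:R + D) ^+ 3.
  rewrite (exprS _ 2) mulrA; apply: ler_pM => //; last first.
    by rewrite ler_pXn2r ?nnegrE // expR_ge0.
  apply: (@le_trans _ _ (2 * n.+1%:R)); first by rewrite -natrM ler_nat; lia.
  exact: ler_pM.
apply: (@le_trans _ _ (expR C * (expR 1 * expR (d / 6 * n%:R + D) ^+ 3))).
  by rewrite ler_wpM2l ?expR_ge0.
rewrite -expRM_natl -!expRD ler_expR; lra.
Unshelve. all: by end_near. Qed.

End Subexponential.

(** * Growth rates *)

Section CursorRatio.
Variables (R : realType) (F : finGroupType).
Implicit Types x : lamplighter F.

Definition cursor_abs x : R := `|(cursor x)%:~R|.

Lemma cursor_absE x : cursor_abs x = (`|cursor x|%N)%:R.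
Proof. by rewrite /cursor_abs -intr_norm -abszE. Qed.

Lemma cursor_ratio_abs n x :
  `|(cursor x)%:~R / n%:R : R| = (`|cursor x|%N)%:R / n%:R.
Proof. by rewrite normrM normfV -/(cursor_abs x) cursor_absE normr_nat. Qed.

Lemma cursor_ratio_le1 n x : lamp_ball n x -> `|(cursor x)%:~R / n%:R : R| <= 1.
Proof.
move=> /lamp_ball_cursor le_J; rewrite cursor_ratio_abs.
case: n le_J => [|n] le_J; first by rewrite invr0 mulr0.
by rewrite ler_pdivrMr // mul1r ler_nat.
Qed.

End CursorRatio.

(** * Upper bounds for subsets of the ball *)

Section Asymptotics.
Variables (R : realType) (F : finGroupType) (r : nat) (rho : R).
Hypotheses (hF : #|F| = r.+1) (r0 : (0 < r)%N) (rho1 : 1 < rho)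
  (rhoE : rho ^+ 3 = rho + r%:R).
Implicit Types x : lamplighter F.

Let pos : 0 < r%:R :> R /\ 1 < rho.
Proof. by rewrite ltr0n r0 rho1. Qed.

Notation beta_star := (beta_star r rho).
Notation tilt := (tilt r rho).
Notation rate := (rate r rho).

Lemma rhoV_le1 : rho^-1 <= 1.
Proof. have [_ rhoG] := pos; rewrite invf_le1; lra. Qed.

(** The slack is a sum of two nonnegative products: the backtracking [H - J] times [- (g + 2 l)],
    and the spare length [N + J - m - 2 H] times [- l]. The constant [ln (1 + r)] pays for the extra
    site, a hull of length [H] having [H + 1] sites. *)
Lemma ball_weight (z : R) n x : 0 < z -> z <= rho^-1 -> lamp_ball n x ->
  (1 + r%:R * z) ^+ (hull_size x).+1
    <= expR (tilted r n%:R (cursor_abs R x) z + ln (1 + r%:R)) * z ^+ lamp_count x.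
Proof.
have [rR rhoG] := pos.
move=> z0 le_z xn; have z1 := le_trans le_z rhoV_le1.
apply: tilted_weight => //; rewrite cursor_absE /tilted.
have lnz : ln z <= 0 by exact: ln_le0.
have base := ln_base_le r0 rho1 rhoE z0 le_z.
have lnr : ln (1 + r%:R * z) <= ln (1 + r%:R).
  by rewrite ler_ln ?posrE ?base_gt0 ?lerD2l ?ler_piMr //; lra.
have le_JH : (`|cursor x|%N)%:R <= (hull_size x)%:R :> R by rewrite ler_nat cursor_hull.
have le_m : (lamp_count x)%:R + 2 * (hull_size x)%:R <= n%:R + (`|cursor x|%N)%:R :> R.
  by rewrite -natrM -!natrD ler_nat; exact: lamp_ball_le.
rewrite -natr1.
move: (ln (1 + r%:R * z)) (ln z) lnz base lnr le_JH le_m => g l l0 gl gr.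
move: (hull_size x)%:R (lamp_count x)%:R (`|cursor x|%N)%:R n%:R => H m J N JH le_m.
have h1 : 0 <= (H - J) * (- (g + 2 * l)) by apply: mulr_ge0; lra.
have h2 : 0 <= (N + J - m - 2 * H) * (- l) by apply: mulr_ge0; lra.
lra.
Qed.

Lemma tilt_ge0 b : `|b| <= 1 -> 0 <= tilt b.
Proof.
rewrite le_eqVlt => /predU1P[b1|b1]; first by rewrite (tilt1 r0 rho1 b1).
by apply/ltW/tilt_gt0.
Qed.

Lemma ball_weight_tilt n x : (0 < n)%N -> lamp_ball n x ->
  let b := (cursor x)%:~R / n%:R in
  (1 + r%:R * tilt b) ^+ (hull_size x).+1
    <= expR (n%:R * rate b + ln (1 + r%:R)) * tilt b ^+ lamp_count x.
Proof.
have [rR rhoG] := pos.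
move=> n0 xn /=; set b := _ / _.
have nR : 0 < n%:R :> R by rewrite ltr0n.
have absb := cursor_ratio_abs R n x; have b1 := cursor_ratio_le1 R xn; rewrite -/b in absb b1.
have [lt_b|ge_b] := ltrP `|b| 1.
  have -> : n%:R * rate b = tilted r n%:R (cursor_abs R x) (tilt b).
    by rewrite /rate -tilted_scale absb divfK ?gt_eqF // cursor_absE.
  by apply: ball_weight => //; [exact: tilt_gt0|exact: tilt_le].
(* A cursor at distance [n] leaves no length for lamps, so the vanishing tilt occurs only to the
   power 0. *)
have bE : `|b| = 1 by lra.
have m0 : lamp_count x = 0%N.
  have Jn := divr1_eq (etrans (esym absb) bE).
  have := lamp_ball_le xn; have := cursor_hull x.
  move/eqP : Jn; rewrite eqr_nat => /eqP; lia.
rewrite (tilt1 r0 rho1 bE) (rate1 r0 rho1 bE) m0 !mulr0 addr0 expr1n mulr1 add0r.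
by rewrite lnK ?posrE; lra.
Qed.

(** Each element is weighted by the tilt of its own cursor ratio, so one bound covers a family
    spread over many cursors. *)
Lemma count_rate_bound n (X : set (lamplighter F)) (s : R) :
  (0 < n)%N -> X `<=` lamp_ball n ->
  (forall x, X x -> rate ((cursor x)%:~R / n%:R) <= s) ->
  (#|` fset_set X|)%:R <= expR (n%:R * s + ln (1 + r%:R)) * class_bound R n.
Proof.
move=> n0 Xn Xs; rewrite /class_bound mulrA.
have b1 x : X x -> `|(cursor x)%:~R / n%:R : R| <= 1 by move=> /Xn; exact: cursor_ratio_le1.
apply: (lamp_count_bound hF (z := fun j => tilt (j%:~R / n%:R))) => //.
  by move=> x /b1 ?; apply: tilt_ge0.
move=> x Xx; have xn := Xn _ Xx.
apply: le_trans (ball_weight_tilt n0 xn) _; rewrite ler_wpM2r //.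
  by rewrite exprn_ge0 // tilt_ge0 // b1.
by rewrite ler_expR lerD2r ler_wpM2l // Xs.
Qed.

Lemma count_weight_bound n (X : set (lamplighter F)) (z e : R) :
  0 < z -> X `<=` lamp_ball n ->
  (forall x, X x -> (hull_size x).+1%:R * ln (1 + r%:R * z)
                    - (lamp_count x)%:R * ln z <= e) ->
  (#|` fset_set X|)%:R <= expR e * class_bound R n.
Proof.
move=> z0 Xn Xe; rewrite /class_bound mulrA.
apply: (lamp_count_bound hF (z := fun=> z)) => //.
  by move=> _ _; exact: ltW.
by move=> x /Xe; exact: tilted_weight.
Qed.

(** With one tilt for all cursors, the tilt of [b] can serve the cursor [floor (b n)]; rounding then
    shifts the exponent by a bounded amount only. *)
Lemma count_tilted_bound n (X : set (lamplighter F)) (z e : R) :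
  0 < z -> z <= rho^-1 -> X `<=` lamp_ball n ->
  (forall x, X x -> tilted r n%:R (cursor_abs R x) z <= e) ->
  (#|` fset_set X|)%:R <= expR (e + ln (1 + r%:R)) * class_bound R n.
Proof.
move=> z0 le_z Xn Xe; rewrite /class_bound mulrA.
apply: (lamp_count_bound hF (z := fun=> z)) => //.
  by move=> _ _; exact: ltW.
move=> x Xx; apply: le_trans (ball_weight z0 le_z (Xn _ Xx)) _.
by rewrite ler_wpM2r ?exprn_ge0 ?ler_expR ?lerD2r ?Xe // ltW.
Qed.

End Asymptotics.

(** * The matching lower bound for one cursor value *)

Section LowerBound.
Variables (R : realType) (F : finGroupType) (r : nat) (rho : R).
Hypotheses (hF : #|F| = r.+1) (r0 : (0 < r)%N) (rho1 : 1 < rho)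
  (rhoE : rho ^+ 3 = rho + r%:R).

Notation tilt := (tilt r rho).
Notation rate := (rate r rho).

(** A modal term is at least a [K.+1]-th of the binomial sum, so keeping only [m] lamps loses a
    polynomial factor. *)
Lemma cursor_count_tilted (z : R) (K k m n : nat) (j : int) : 0 < z ->
  (K <= `|j| + k)%N -> (m + `|j| + 2 * k <= n)%N ->
  (1 + r%:R * z) ^+ K <= K.+1%:R * ('C(K, m)%:R * (r%:R * z) ^+ m) ->
  expR (K%:R * ln (1 + r%:R * z) - m%:R * ln z)
    <= n.+1%:R * (cursor_count F j n)%:R.
Proof.
move=> z0 le_K le_n le_mode.
have g0 : 0 < 1 + r%:R * z by exact/base_gt0/ltW.
rewrite expRD expRN !expRM_natl !lnK // ler_pdivrMr ?exprn_gt0 //.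
apply: le_trans le_mode _; rewrite exprMn mulrA mulrA.
rewrite ler_pM2r ?exprn_gt0 // -mulrA -natrX -!natrM.
rewrite ler_nat; apply: leq_mul; first by lia.
exact: cursor_count_ge hF le_K le_n.
Qed.

(** Take a sweep over about [(|b| + kap) n] sites, backtracking [kap n] and the modal number of
    lamps. By the mean equation for [kap] this number is about [(1 - |b| - 2 kap) n], just what the
    length budget leaves. *)
Lemma cursor_count_lower b : `|b| < 1 -> exists C : R, exists N : nat,
  forall n (j : int), (N <= n)%N -> `| `|j%:~R| - `|b| * n%:R | <= 1 :> R ->
  expR (n%:R * rate b - C) <= n.+1%:R * (cursor_count F j n)%:R.
Proof.
move=> b1; have z0 := tilt_gt0 r0 rho1 b1.
have [kap [kap0 kapE th0 kap_ln]] := tilt_kappa r0 rho1 rhoE b1.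
have lnz : ln (tilt b) <= 0.
  apply: ln_le0; apply: le_trans (tilt_le r0 rho1 (ltW b1)) _.
  exact: (rhoV_le1 r0 rho1).
have rR : 0 < r%:R :> R by rewrite ltr0n.
have rateE : rate b = `|b| * ln (1 + r%:R * tilt b) - (1 - `|b|) * ln (tilt b) by [].
move: (tilt b) z0 kapE kap_ln lnz rateE => z z0 kapE kap_ln lnz rateE.
set q := r%:R * z in kapE kap_ln rateE; set g := ln (1 + q) in kap_ln rateE.
have q0 : 0 < q by exact: mulr_gt0.
have q1 : 0 < 1 + q by lra.
have g0 : 0 <= g by apply: ln_ge0; lra.
set th := `|b| + kap in th0 kapE.
(* The sweep is shortened by [c] sites. [c >= 2] covers the rounding of [|j|] and [k] in the hull
   constraint; [(c - 1) q >= 1 + q] frees one lamp, which pays for [|j|] exceeding [|b| n] by up to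
   1. *)
pose c := (Num.truncn ((1 + q) / q)).+2.
have le_c : 1 + q <= (c%:R - 1) * q.
  have qq : 0 <= (1 + q) / q by apply/ltW/divr_gt0.
  have -> : c%:R - 1 = (Num.truncn ((1 + q) / q)).+1%:R :> R by rewrite /c -natr1 addrK.
  by rewrite -ler_pdivrMr //; have /andP[_ /ltW] := truncn_itv qq.
have c2 : 2 <= c%:R :> R by rewrite ler_nat.
pose p := q / (1 + q); have pE : p * (1 + q) = q by rewrite divfK // gt_eqF.
have p0 : 0 < p by exact: divr_gt0.
pose lam := - ln z; have lam0 : 0 <= lam by rewrite oppr_ge0.
(* The two sides differ by [kap * (g + 2 * ln z)], which is 0 by [kap_ln]. *)
have thE : th * (g + p * lam) = rate b.
  have tp : th * p = 1 - `|b| - 2 * kap.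
    have qn0 : 1 + q != 0 by rewrite gt_eqF.
    by apply: (mulIf qn0); rewrite -mulrA pE kapE mulrC.
  rewrite rateE mulrDr mulrA tp /lam /th; lra.
(* The constant collects the losses in [K >= th n - 1 - c] and [m >= p (K + 1) - 1]; the threshold
   ensures [c <= T], so that the truncated difference [T - c] is exact. *)
exists ((1 + c%:R) * (g + p * lam) + lam), (Num.truncn ((c%:R + 1) / th)).+1.
move=> n j le_n le_j.
have thn : c%:R + 1 <= th * n%:R.
  have cc : 0 <= (c%:R + 1) / th by apply: divr_ge0; lra.
  have /andP[_ /ltW] := truncn_itv cc; rewrite ler_pdivrMr // => /le_trans; apply.
  by rewrite mulrC ler_wpM2l ?ler_nat // ltW.
have thn0 : 0 <= th * n%:R by lra.
have kn0 : 0 <= kap * n%:R by exact: mulr_ge0.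
have /andP[T1 T2] := truncn_itv thn0; have /andP[k1 k2] := truncn_itv kn0.
set T := Num.truncn (th * n%:R) in T1 T2; set k := Num.truncn (kap * n%:R) in k1 k2.
have le_cT : (c <= T)%N by rewrite truncn_ge_nat //; lra.
have KE : (T - c)%N%:R = T%:R - c%:R :> R by rewrite natrB.
rewrite -natr1 in T2; rewrite -natr1 in k2.
have jE : `|j%:~R| = (`|j|%N)%:R :> R by rewrite -intr_norm -abszE.
rewrite jE in le_j; move: le_j; rewrite ler_norml => /andP[j1 j2].
have thnE : th * n%:R = `|b| * n%:R + kap * n%:R by rewrite /th mulrDl.
set K := (T - c)%N in KE *.
have le_K : (K <= `|j| + k)%N.
  rewrite -ltnS -(ltr_nat R) -natr1 natrD KE; lra.
have [m [_ m1 m2 mode]] := binom_mode K (ltW q0).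
rewrite -natr1 in m1; rewrite -!natr1 in m2.
have le_m : (m + `|j| + 2 * k <= n)%N.
  rewrite mul2n -addnn -(ler_nat R) !natrD -(ler_pM2r q1).
  have e1 : K%:R * q <= (th * n%:R - c%:R) * q by rewrite ler_wpM2r //; lra.
  have e2 : th * n%:R * q = (1 - `|b| - 2 * kap) * (1 + q) * n%:R.
    by rewrite kapE; ring.
  have e3 : (`|j|%N)%:R * (1 + q) <= (`|b| * n%:R + 1) * (1 + q).
    by rewrite ler_wpM2r //; lra.
  have e4 : k%:R * (1 + q) <= kap * n%:R * (1 + q) by rewrite ler_wpM2r //; lra.
  lra.
apply: le_trans (cursor_count_tilted z0 le_K le_m mode).
rewrite ler_expR -/q -/g -thE.
have le_pm : p * (K%:R + 1) - 1 <= m%:R.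
  rewrite -(ler_pM2r q1) mulrBl mulrAC pE; lra.
have f1 : (p * (K%:R + 1) - 1) * lam <= m%:R * lam by exact: ler_wpM2r.
have f2 : (th * n%:R - 1 - c%:R) * (g + p * lam) <= K%:R * (g + p * lam).
  apply: ler_wpM2r; last by lra.
  by apply: addr_ge0 => //; apply: mulr_ge0 => //; exact: ltW.
have f3 : 0 <= p * lam by apply: mulr_ge0 => //; exact: ltW.
have -> : ln z = - lam by rewrite opprK.
lra.
Qed.

End LowerBound.

Lemma floor_abs_dist (R : realType) (b : R) n :
  `| `|(Num.floor (b * n%:R))%:~R| - `|b| * n%:R | <= 1 :> R.
Proof.
rewrite -[X in _ - _ * X]normr_nat -normrM; apply: le_trans (ler_dist_dist _ _) _.
have := floor_itv (b * n%:R); rewrite intrD => /andP[? ?].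
by rewrite ler_norml; apply/andP; split; lra.
Qed.

Lemma floor_abs_le (R : realType) (b : R) n : `|b| <= 1 -> (`|Num.floor (b * n%:R)| <= n)%N.
Proof.
rewrite ler_norml => /andP[b1 b2]; have n0 : 0 <= n%:R :> R by [].
have h1 : - n%:Z <= Num.floor (b * n%:R).
  by rewrite floor_ge_int intrN -mulN1r ler_wpM2r.
have h2 : Num.floor (b * n%:R) <= n%:Z.
  rewrite -(ler_int R); apply: le_trans (floor_le _) _.
  by rewrite -[leRHS]mul1r ler_wpM2r.
lia.
Qed.

Lemma cursor_count_gt0 (F : finGroupType) (j : int) n : (`|j| <= n)%N -> (0 < cursor_count F j n)%N.
Proof.
have hF : #|F| = #|F|.-1.+1 by rewrite prednK //; apply/card_gt0P; exists 1%g.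
move=> le_j; have := @cursor_count_ge F #|F|.-1 0 0 0 n j hF.
by rewrite bin0 expn0; apply => //; lia.
Qed.

(** * The limit defining the growth spectrum *)

Section Spectrum.
Variables (R : realType) (F : finGroupType) (r : nat) (rho : R).
Hypotheses (hF : #|F| = r.+1) (r0 : (0 < r)%N) (rho1 : 1 < rho)
  (rhoE : rho ^+ 3 = rho + r%:R).

Notation tilt := (tilt r rho).
Notation rate := (rate r rho).

Lemma cursor_count_rate_lower (b d : R) : `|b| <= 1 -> 0 < d ->
  \forall n \near \oo, expR (n%:R * (rate b - d))
    <= (cursor_count F (Num.floor (b * n%:R)) n)%:R.
Proof.
move=> b1 d0; have [lt_b|ge_b] := ltrP `|b| 1; last first.
  have bE : `|b| = 1 by apply/le_anti; rewrite b1.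
  near=> n; rewrite (rate1 r0 rho1 bE) sub0r.
  apply: (@le_trans _ _ 1); last by rewrite ler1n cursor_count_gt0 // floor_abs_le.
  by rewrite -expR0 ler_expR mulrN oppr_le0 mulr_ge0 // ltW.
have [C [N leC]] := cursor_count_lower hF r0 rho1 rhoE lt_b.
near=> n; have le_N : (N <= n)%N by near: n; exact: nbhs_infty_ge.
have := leC n _ le_N (floor_abs_dist b n); set c := (cursor_count _ _ _)%:R => le_c.
have le_n : expR C * n.+1%:R <= expR (d * n%:R).
  apply: (@le_trans _ _ (expR C * class_bound R n)).
    by rewrite ler_wpM2l ?expR_ge0 // class_bound_ge.
  by near: n; exact: class_bound_subexp.
have le1 : expR (C - d * n%:R) * n.+1%:R <= 1.
  by rewrite expRD expRN mulrAC ler_pdivrMr ?expR_gt0 // mul1r.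
have -> : n%:R * (rate b - d) = (C - d * n%:R) + (n%:R * rate b - C) by ring.
rewrite expRD; apply: (@le_trans _ _ (expR (C - d * n%:R) * (n.+1%:R * c))).
  by rewrite ler_wpM2l ?expR_ge0.
by rewrite mulrA ler_piMl.
Unshelve. all: by end_near. Qed.

Lemma tilted_near (b z : R) (s t : R) : `|s - b * t| <= 1 ->
  tilted r t s z <= t * tilted r 1 b z + `|ln (1 + r%:R * z) + ln z|.
Proof.
move=> le_s; rewrite -tilted_scale.
have -> : tilted r t s z = tilted r t (b * t) z + (s - b * t) * (ln (1 + r%:R * z) + ln z).
  by rewrite /tilted; ring.
rewrite lerD2l; apply: le_trans (ler_norm _) _.
by rewrite normrM ler_piMl.
Qed.

Lemma cursor_count_rate_upper (b d : R) : `|b| <= 1 -> 0 < d ->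
  \forall n \near \oo, (cursor_count F (Num.floor (b * n%:R)) n)%:R
    <= expR (n%:R * (rate b + d)).
Proof.
move=> b1 d0.
pose X n : set (lamplighter F) := [set x | lamp_ball n x /\ cursor x = Num.floor (b * n%:R)].
have XB n : X n `<=` lamp_ball n by move=> x [].
suff [C leC] : exists C : R, forall n : nat, (0 < n)%N ->
    (#|` fset_set (X n)|)%:R <= expR (n%:R * rate b + C) * class_bound R n.
  near=> n; have n0 : (0 < n)%N by near: n; exact: nbhs_infty_gt.
  apply: le_trans (leC n n0) _.
  have -> : n%:R * (rate b + d) = n%:R * rate b + d * n%:R by ring.
  rewrite !expRD -mulrA ler_pM2l ?expR_gt0 //.
  by near: n; exact: class_bound_subexp.
have [lt_b|ge_b] := ltrP `|b| 1.
  have z0 := tilt_gt0 r0 rho1 lt_b.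
  exists (`|ln (1 + r%:R * tilt b) + ln (tilt b)| + ln (1 + r%:R)) => n n0.
  rewrite addrA; apply: (count_tilted_bound hF r0 rho1 rhoE z0) => //.
    exact: (tilt_le r0 rho1 (ltW lt_b)).
  by move=> x [_ xj]; apply: tilted_near; rewrite /cursor_abs xj floor_abs_dist.
(* At [|b| = 1] the tilt is 0, outside the range of the fixed-tilt bound; but [b n] is then an
   integer, so there is no rounding and the cursor ratio is [b] itself. *)
exists (ln (1 + r%:R)) => n n0; apply: (count_rate_bound hF r0 rho1 rhoE n0) => // x [_ ->].
have nR : n%:R != 0 :> R by rewrite pnatr_eq0 -lt0n.
suff -> : (Num.floor (b * n%:R))%:~R / n%:R = b by [].
apply: (mulIf nR); rewrite divfK //; apply/eqP; rewrite -intrEfloor.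
have [b0|b0] := ger0P b.
  have -> : b = 1 by move: b1 ge_b; rewrite ger0_norm // => *; lra.
  by rewrite mul1r; exact: rpred_nat.
have -> : b = -1 by move: b1 ge_b; rewrite ltr0_norm // => *; lra.
by rewrite mulN1r rpredN rpred_nat.
Unshelve. all: by end_near. Qed.

Lemma spectrum_cvg (b : R) : `|b| <= 1 ->
  (fun n : nat => n%:R^-1 * ln (cursor_count F (Num.floor (b * n%:R)) n)%:R : R)
    @ \oo --> rate b.
Proof.
move=> b1; apply/cvgrPdist_le => d d0; near=> n.
have n0 : 0 < n%:R :> R by rewrite ltr0n; near: n; exact: nbhs_infty_gt.
have lo : expR (n%:R * (rate b - d)) <= (cursor_count F (Num.floor (b * n%:R)) n)%:R.
  by near: n; exact: cursor_count_rate_lower.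
have up : (cursor_count F (Num.floor (b * n%:R)) n)%:R <= expR (n%:R * (rate b + d)).
  by near: n; exact: cursor_count_rate_upper.
have c0 := lt_le_trans (expR_gt0 _) lo.
set c := (cursor_count _ _ _)%:R in lo up c0 *.
have {}lo : n%:R * (rate b - d) <= ln c by rewrite -ler_expR lnK.
have {}up : ln c <= n%:R * (rate b + d) by rewrite -ler_expR lnK.
by rewrite distrC ler_distl mulrC ler_pdivlMr // ler_pdivrMr // ![_ * n%:R]mulrC lo up.
Unshelve. all: by end_near. Qed.

Lemma growth_spectrumE (b : R) : `|b| <= 1 -> growth_spectrum F b = rate b.
Proof. by move=> b1; apply/cvg_lim => //; exact: spectrum_cvg. Qed.

End Spectrum.

(** * Concentration and large deviations *)

Lemma card_fset_set_le (T : choiceType) (A B : set T) :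
  finite_set B -> A `<=` B -> (#|` fset_set A| <= #|` fset_set B|)%N.
Proof.
move=> finB AB; apply/fsubset_leq_card; rewrite -fset_set_sub //.
exact: sub_finite_set finB.
Qed.

(** * Size of the ball and rare events in it *)

Section Ball.
Variables (R : realType) (F : finGroupType) (r : nat) (rho omega : R).
Hypotheses (hF : #|F| = r.+1) (r0 : (0 < r)%N) (rho1 : 1 < rho)
  (rhoE : rho ^+ 3 = rho + r%:R)
  (omega1 : 1 < omega) (omegaE : omega ^+ 2 = omega + r%:R).

Notation tilt := (tilt r rho).
Notation rate := (rate r rho).
Notation beta_bar := (beta_bar r omega).
Notation beta_star := (beta_star r rho).
Notation ballsize n := (#|` fset_set (@lamp_ball F n)|).

Let bar_bounds : [/\ 1 / 2 < beta_star, beta_star < beta_bar, beta_bar < 1,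
  0 < ln omega & 0 < omega^-1].
Proof.
split; first exact: (beta_star_half r0 rho1).
- exact: (beta_star_lt_bar r0 rho1 rhoE omega1 omegaE).
- exact: (beta_bar_lt1 r0 omega1 omegaE).
- exact: ln_gt0.
- by rewrite invr_gt0; apply: lt_trans omega1.
Qed.

(** The single cursor value [floor (beta_bar n)] already carries the full exponent. *)
Lemma ball_rate_lower (d : R) : 0 < d ->
  \forall n \near \oo, expR (n%:R * (ln omega - d)) <= (ballsize n)%:R.
Proof.
move=> d0; have [half lt_bar bar1 _ _] := bar_bounds.
have bar : `|beta_bar| <= 1 by rewrite ger0_norm; lra.
have rb : rate beta_bar = ln omega by exact: rate_bar.
near=> n; rewrite -rb.
apply: (@le_trans _ _ (cursor_count F (Num.floor (beta_bar * n%:R)) n)%:R).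
  by near: n; exact: cursor_count_rate_lower.
rewrite ler_nat; apply: card_fset_set_le; first exact: finite_lamp_ball.
by move=> x [].
Unshelve. all: by end_near. Qed.

Lemma ball_gt0 n : (0 < ballsize n)%N.
Proof.
apply: leq_trans (@cursor_count_gt0 F 0 n (leq0n n)) _.
by apply: card_fset_set_le; [exact: finite_lamp_ball|move=> x []].
Qed.

Lemma ball_rate_upper (d : R) : 0 < d ->
  \forall n \near \oo, (ballsize n)%:R <= expR (n%:R * (ln omega + d)).
Proof.
move=> d0; near=> n; have n0 : (0 < n)%N by near: n; exact: nbhs_infty_gt.
apply: le_trans (count_rate_bound hF r0 rho1 rhoE (s := ln omega) n0 _ _) _ => //.
  by move=> x xn; apply: (rate_le r0 rho1 rhoE omega1 omegaE); exact: cursor_ratio_le1.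
have -> : n%:R * (ln omega + d) = n%:R * ln omega + d * n%:R by ring.
rewrite !expRD -mulrA ler_pM2l ?expR_gt0 //.
by near: n; exact: class_bound_subexp.
Unshelve. all: by end_near. Qed.

Definition event_prob (A : set (lamplighter F)) n : R :=
  (#|` fset_set (A `&` @lamp_ball F n)|)%:R / (ballsize n)%:R.

Lemma event_prob_ge0 A n : 0 <= event_prob A n.
Proof. by rewrite divr_ge0. Qed.

Lemma event_prob_le A B n : (A `&` @lamp_ball F n) `<=` B ->
  event_prob A n <= event_prob B n.
Proof.
move=> AB; rewrite ler_pM2r ?invr_gt0 ?ltr0n ?ball_gt0 // ler_nat.
apply: card_fset_set_le => [|x [Ax xn]]; last by split=> //; apply: AB.
exact: sub_finite_set (@subIsetr _ _ _) (finite_lamp_ball F n).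
Qed.

Lemma event_probU A B n : event_prob (A `|` B) n <= event_prob A n + event_prob B n.
Proof.
rewrite -mulrDl ler_pM2r ?invr_gt0 ?ltr0n ?ball_gt0 // -natrD ler_nat setIUl.
have fin X : finite_set (X `&` @lamp_ball F n).
  exact: sub_finite_set (@subIsetr _ _ _) (finite_lamp_ball F n).
by rewrite fset_setU // cardfsU leq_subr.
Qed.

Lemma event_prob_decay (X : nat -> set (lamplighter F)) (s C c : R) :
  c < ln omega - s ->
  (forall n, (0 < n)%N -> (#|` fset_set (X n `&` @lamp_ball F n)|)%:R
     <= expR (n%:R * s + C) * class_bound R n) ->
  \forall n \near \oo, event_prob (X n) n <= expR (- (c * n%:R)).
Proof.
(* Half of the gap pays for the polynomial factor, half for the lower bound on the ball. *)
move=> lt_c leX; pose d := (ln omega - s - c) / 2; have d0 : 0 < d by rewrite /d; lra.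
near=> n; have n0 : (0 < n)%N by near: n; exact: nbhs_infty_gt.
have lo : expR (n%:R * (ln omega - d)) <= (ballsize n)%:R.
  by near: n; exact: ball_rate_lower.
have up : expR C * class_bound R n <= expR (d * n%:R).
  by near: n; exact: class_bound_subexp.
rewrite ler_pdivrMr ?ltr0n ?ball_gt0 //; apply: le_trans (leX n n0) _.
apply: (@le_trans _ _ (expR (- (c * n%:R)) * expR (n%:R * (ln omega - d)))); last first.
  by rewrite ler_wpM2l ?expR_ge0.
rewrite expRD -mulrA; apply: (@le_trans _ _ (expR (n%:R * s) * expR (d * n%:R))).
  by rewrite ler_wpM2l ?expR_ge0.
rewrite -!expRD ler_expR /d; lra.
Unshelve. all: by end_near. Qed.

(** At [omega^-1] only lamps plus hull matters; the added [ln omega] is the last hull site. *)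
Lemma short_weight n x (d : R) :
  (lamp_count x)%:R + (hull_size x)%:R <= (1 - d) * n%:R ->
  (hull_size x).+1%:R * ln (1 + r%:R * omega^-1) - (@lamp_count F x)%:R * ln omega^-1
    <= n%:R * ((1 - d) * ln omega) + ln omega.
Proof.
have lno : 0 < ln omega by exact: ln_gt0.
move=> le_x; rewrite omega_base // lnV ?posrE; last by apply: lt_trans omega1.
have : ((lamp_count x)%:R + (hull_size x)%:R) * ln omega <= (1 - d) * n%:R * ln omega.
  by rewrite ler_wpM2r // ltW.
rewrite -natr1; lra.
Qed.

(* Changes sign at [beta_bar], because [z * (1 + r * z) = 1] at [z = omega^-1]. *)
Definition hull_gain (b : R) : R :=
  ln (1 + r%:R * opt_tilt r b) + ln (opt_tilt r b).

(** Both logarithms increase with the tilt, which decreases in [b], and their sum vanishes at the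
    tilt [omega^-1] of [beta_bar]. *)
Lemma hull_gainE b : 1 / 2 < b < 1 -> beta_star <= b -> 0 <= (beta_bar - b) * hull_gain b.
Proof.
move=> b1 star_b; have [half lt_bar bar1 lno om0] := bar_bounds.
have z0 : 0 < opt_tilt r b by exact: opt_tilt_gt0.
have gain0 : ln (1 + r%:R * omega^-1) + ln omega^-1 = 0.
  by rewrite omega_base // lnV ?subrr // posrE; apply: lt_trans omega1.
have zbar : opt_tilt r beta_bar = omega^-1 by exact: opt_tilt_bar.
have g0 (z : R) : 0 < z -> 1 + r%:R * z \is Num.pos by move=> ?; rewrite posrE base_gt0 ?ltW.
have [le_b|lt_b] := lerP b beta_bar.
  apply: mulr_ge0; first by lra.
  have le_z : omega^-1 <= opt_tilt r b by rewrite -zbar opt_tilt_le //; lra.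
  rewrite -gain0 /hull_gain lerD // ler_ln ?g0 ?posrE //.
  by rewrite lerD2l ler_wpM2l.
apply: mulr_le0; first by lra.
have le_z : opt_tilt r b <= omega^-1 by rewrite -zbar opt_tilt_le //; lra.
rewrite -gain0 /hull_gain lerD // ler_ln ?g0 ?posrE //.
by rewrite lerD2l ler_wpM2l.
Qed.

(** Lamps plus hull is at most [n], and trading a lamp for a hull site changes the exponent by
    [hull_gain b]; on the side where that does not help, the hull [b n] is the extreme case. *)
Lemma hull_weight n x (b : R) : 1 / 2 < b < 1 -> beta_star <= b -> lamp_ball n x ->
  ((hull_size x)%:R - b * n%:R) * hull_gain b <= 0 ->
  (hull_size x).+1%:R * ln (1 + r%:R * opt_tilt r b)
      - (@lamp_count F x)%:R * ln (opt_tilt r b)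
    <= n%:R * tilted r 1 b (opt_tilt r b) + ln (1 + r%:R * opt_tilt r b).
Proof.
move=> b1 star_b xn le_g; have [half _ _ _ _] := bar_bounds.
have lnz : ln (opt_tilt r b) <= 0.
  apply: ln_le0; apply: le_trans (rhoV_le1 r0 rho1).
  by rewrite -(opt_tilt_star r0 rho1); apply: opt_tilt_le => //; lra.
have le_m : (lamp_count x)%:R + (hull_size x)%:R <= n%:R :> R.
  by rewrite -natrD ler_nat lamp_hull_le.
have h : 0 <= (n%:R - (lamp_count x)%:R - (hull_size x)%:R) * - ln (opt_tilt r b).
  by apply: mulr_ge0; lra.
move: le_g; rewrite /hull_gain -natr1 /tilted; lra.
Qed.

End Ball.

(** * Logarithmic limits and exponential decay *)

Section LimnEsup.
Variable R : realType.
Implicit Types (u : (\bar R)^nat) (c : \bar R).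

Lemma limn_esup_le_near u c : (\forall n \near \oo, (u n <= c)%E) -> (limn_esup u <= c)%E.
Proof.
move=> uc; rewrite /limn_esup limf_esupE.
apply: (@le_trans _ _ (ereal_sup (u @` [set n | (u n <= c)%E]))).
  by apply: ereal_inf_lbound; exists [set n | (u n <= c)%E].
by apply: ge_ereal_sup => _ [n nc <-].
Qed.

Lemma limn_einf_ge_near u c : (\forall n \near \oo, (c <= u n)%E) -> (c <= limn_einf u)%E.
Proof.
move=> uc; rewrite /limn_einf leeNr; apply: limn_esup_le_near.
by apply: filterS uc => n; rewrite leeN2.
Qed.

Lemma lne_rate_le (p c : R) n : (0 < n)%N -> 0 <= p -> p <= expR (c * n%:R) ->
  ((n%:R^-1)%:E * lne p%:E <= c%:E)%E.
Proof.
move=> n0 p0 le_p; have nR : 0 < n%:R :> R by rewrite ltr0n.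
have [->|pn0] := eqVneq p 0; first by rewrite le0_lneNy // gt0_muleNy ?lte_fin ?invr_gt0 // leNye.
have pp : 0 < p by rewrite lt_def pn0.
by rewrite lne_EFin // -EFinM lee_fin mulrC ler_pdivrMr // -ler_expR lnK.
Qed.

Lemma lne_rate_ge (p c : R) n : (0 < n)%N -> expR (c * n%:R) <= p ->
  (c%:E <= (n%:R^-1)%:E * lne p%:E)%E.
Proof.
move=> n0 le_p; have nR : 0 < n%:R :> R by rewrite ltr0n.
have pp := lt_le_trans (expR_gt0 _) le_p.
by rewrite lne_EFin // -EFinM lee_fin mulrC ler_pdivlMr // -ler_expR lnK.
Qed.

(** A constant of at least [expR (c * N)] makes the bound exceed 1 for the finitely many [n < N]. *)
Lemma exponentially_small_near (p : nat -> \bar R) (K c : R) :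
  (forall n, p n <= 1)%E -> 0 < K -> 0 < c ->
  (\forall n \near \oo, (p n <= (K * expR (- (c * n%:R)))%:E)%E) ->
  exponentially_small p.
Proof.
move=> p1 K0 c0 [N _ pN]; exists (Num.max K (expR (c * N%:R))), c.
split=> // [|n n0]; first by rewrite lt_max K0.
have [le_n|lt_n] := leqP N n.
  apply: le_trans (pN n le_n) _.
  by rewrite lee_fin ler_wpM2r ?expR_ge0 // le_max lexx.
apply: le_trans (p1 n) _; rewrite lee_fin.
apply: (@le_trans _ _ (expR (c * N%:R) * expR (- (c * n%:R)))).
  have le_nN : n%:R <= N%:R :> R by rewrite ler_nat ltnW.
  rewrite -expRD; apply: le_trans (expR_ge1Dx _); rewrite lerDl subr_ge0.
  exact: ler_wpM2l (ltW c0) _ _ le_nN.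
by rewrite ler_wpM2r ?expR_ge0 // le_max lexx orbT.
Qed.

Lemma exponentially_small_cvg (p : nat -> \bar R) :
  (forall n, 0 <= p n)%E -> exponentially_small p -> p @ \oo --> 0%E.
Proof.
move=> p0 [C [c [C0 c0 pC]]].
(* Then [expR (c n) >= 1 + c n >= k (n + 1)], so a multiple of the harmonic sequence dominates. *)
pose k := Num.min 1 c; have k0 : 0 < k by rewrite lt_min c0 ltr01.
have [k1 kc] : k <= 1 /\ k <= c by rewrite !ge_min !lexx orbT.
apply: (@squeeze_cvge _ _ _ _ (fun=> 0%E) _ (fun n => (C / k * harmonic n)%:E)).
- near=> n; have n0 : (0 < n)%N by near: n; exact: nbhs_infty_gt.
  rewrite p0 /=; apply: le_trans (pC n n0) _; rewrite lee_fin expRN -mulrA ler_pM2l //.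
  rewrite -invfM lef_pV2 ?posrE ?mulr_gt0 ?expR_gt0 //.
  apply: le_trans (expR_ge1Dx _); rewrite -natr1 mulrDr mulr1 addrC lerD //.
  by rewrite ler_wpM2r.
- exact: cvg_cst.
- apply: cvg_EFin; first by apply: nearW.
  rewrite -[0](mulr0 (C / k)); apply: cvgM; first exact: cvg_cst.
  exact: cvg_harmonic.
Unshelve. all: by end_near. Qed.

End LimnEsup.

(** * Large deviations of the cursor *)

Section LargeDeviations.
Variables (R : realType) (F : finGroupType) (r : nat) (rho omega : R).
Hypotheses (hF : #|F| = r.+1) (r0 : (0 < r)%N) (rho1 : 1 < rho)
  (rhoE : rho ^+ 3 = rho + r%:R)
  (omega1 : 1 < omega) (omegaE : omega ^+ 2 = omega + r%:R).

Notation rate := (rate r rho).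
Notation beta_bar := (beta_bar r omega).
Notation beta_star := (beta_star r rho).
Notation J b := (ln omega - growth_spectrum F (b : R)).

Definition cursor_event n (A : set R) : set (lamplighter F) :=
  [set x | A ((cursor x)%:~R / n%:R)].

Lemma growth_rate b : -1 <= b <= 1 -> growth_spectrum F b = rate b.
Proof. by rewrite -ler_norml => b1; exact: growth_spectrumE. Qed.

Lemma rate_fun_ge0 b : -1 <= b <= 1 -> 0 <= J b.
Proof.
move=> b1; rewrite growth_rate // subr_ge0.
by apply: rate_le r0 rho1 rhoE omega1 omegaE _ _; rewrite ler_norml.
Qed.

Lemma rate_fun_eq0 b : -1 <= b <= 1 -> (J b = 0 <-> b = beta_bar \/ b = - beta_bar).
Proof.
move=> b1; have b1' : `|b| <= 1 by rewrite ler_norml.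
have half := beta_star_half r0 rho1.
have lt_bar := beta_star_lt_bar r0 rho1 rhoE omega1 omegaE.
have bar0 : 0 < beta_bar by lra.
have rbar := rate_bar r0 rho1 rhoE omega1 omegaE.
rewrite growth_rate //; split.
- have [bE _|bne /eqP] := eqVneq `|b| beta_bar.
    by move: bE; have [_ ->|_ <-] := ger0P b; [left|right; rewrite opprK].
  by rewrite subr_eq0 gt_eqF // (rate_lt r0 rho1 rhoE omega1 omegaE).
- by case=> ->; rewrite ?rateN rbar subrr.
Qed.

Lemma rate_fun_affine b : - beta_star <= b <= beta_star ->
  J b = - ln rho * `|b| + (ln omega - ln rho).
Proof.
rewrite -ler_norml => b_star; have star1 := beta_star_lt1 r0 rho1.
rewrite growth_rate -?ler_norml; last by apply: le_trans b_star (ltW star1).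
by rewrite rate_star //; ring.
Qed.

(** With [w] the infimum of [J], all cursor ratios in [A] have rate at most [ln omega - w], and
    [count_rate_bound] treats them together. *)
Lemma ldp_upper (A : set R) : A `<=` `[-1, 1] ->
  (limn_esup (fun n => (n%:R^-1)%:E * lne (event_prob R (cursor_event n A) n)%:E)
    <= - ereal_inf [set (J x)%:E | x in A])%E.
Proof.
move=> A1; have A1' b : A b -> -1 <= b <= 1 by move=> /A1; rewrite /= in_itv.
have [->|/set0P[a Aa]] := eqVneq A set0.
  rewrite image_set0 ereal_inf0; apply: limn_esup_le_near; near=> n.
  have nR : 0 < n%:R :> R by rewrite ltr0n; near: n; exact: nbhs_infty_gt.
  have -> : event_prob R (cursor_event n set0) n = 0.
    have -> : cursor_event n set0 = set0 by apply/seteqP; split.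
    by rewrite /event_prob set0I fset_set0 cardfs0 mul0r.
  by rewrite le0_lneNy // gt0_muleNy // lte_fin invr_gt0.
set v := ereal_inf _.
have v0 : (0 <= v)%E.
  by apply: le_ereal_inf_tmp => _ [b Ab <-]; rewrite lee_fin rate_fun_ge0 // A1'.
have va : (v <= (J a)%:E)%E by apply: ereal_inf_lbound; exists a.
have vfin : v \is a fin_num.
  by rewrite ge0_fin_numE // (le_lt_trans va) // ltry.
rewrite -(fineK vfin); set w := fine v.
have Jw b : A b -> w <= J b.
  by move=> Ab; rewrite -lee_fin fineK //; apply: ereal_inf_lbound; exists b.
apply/lee_addgt0Pr => d d0; apply: limn_esup_le_near.
have dec := @event_prob_decay R F r rho omega hF r0 rho1 rhoE omega1 omegaE
  (fun n => cursor_event n A) (ln omega - w) (ln (1 + r%:R)) (w - d).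
near=> n; have n0 : (0 < n)%N by near: n; exact: nbhs_infty_gt.
rewrite -EFinN -EFinD; apply: lne_rate_le => //; first exact: event_prob_ge0.
have -> : (- w + d) * n%:R = - ((w - d) * n%:R) by ring.
near: n; apply: dec => [|n n0]; first by lra.
apply: (count_rate_bound hF r0 rho1 rhoE n0) => [x []//|x [Ax xn]].
have := Jw _ Ax; rewrite growth_rate ?A1' //; lra.
Unshelve. all: by end_near. Qed.

(** For each [b] in [G] the single cursor [floor (b n)] suffices: its ratio to [n] tends to [b],
    hence is eventually in the open set [U]. *)
Lemma ldp_lower (U : set R) : open U ->
  let G := U `&` `[-1, 1] in
  (- ereal_inf [set (J x)%:E | x in G]
    <= limn_einf (fun n => (n%:R^-1)%:E * lne (event_prob R (cursor_event n G) n)%:E))%E.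
Proof.
move=> oU /=; rewrite leeNl; apply: le_ereal_inf_tmp => _ [b [Ub +] <-].
rewrite /= in_itv /= => b1; have b1' : `|b| <= 1 by rewrite ler_norml.
rewrite leeNl -EFinN; apply/lee_subgt0Pr => d d0; apply: limn_einf_ge_near.
have d2 : 0 < d / 2 by lra.
have lo := cursor_count_rate_lower hF r0 rho1 rhoE b1' d2.
have up := ball_rate_upper hF r0 rho1 rhoE omega1 omegaE d2.
have floor_cvg : (fun n => (Num.floor (b * n%:R))%:~R / n%:R : R) @ \oo --> b.
  apply/cvgrPdist_le => e e0; near=> n.
  have n0 : 0 < n%:R :> R by rewrite ltr0n; near: n; exact: nbhs_infty_gt.
  have ne : e^-1 <= n%:R by near: n; exact: nbhs_infty_ger.
  have := floor_itv (b * n%:R); rewrite intrD => /andP[f1 f2].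
  rewrite distrC ler_distl ler_pdivlMr // ler_pdivrMr //.
  have en : 1 <= e * n%:R by rewrite mulrC -ler_pdivrMr // div1r.
  by apply/andP; split; lra.
have nearU : \forall n \near \oo, U ((Num.floor (b * n%:R))%:~R / n%:R : R).
  by apply: floor_cvg; apply: open_nbhs_nbhs.
near=> n; have n0 : (0 < n)%N by near: n; exact: nbhs_infty_gt.
have nR : 0 < n%:R :> R by rewrite ltr0n.
apply: lne_rate_ge => //.
have lo' : expR (n%:R * (rate b - d / 2))
    <= (cursor_count F (Num.floor (b * n%:R)) n)%:R by near: n.
have up' : (#|` fset_set (@lamp_ball F n)|)%:R <= expR (n%:R * (ln omega + d / 2)).
  by near: n.
have nearU' : U ((Num.floor (b * n%:R))%:~R / n%:R : R) by near: n.
rewrite ler_pdivlMr ?ltr0n ?ball_gt0 //.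
apply: (@le_trans _ _ (expR ((- J b - d) * n%:R) * expR (n%:R * (ln omega + d / 2)))).
  by rewrite ler_wpM2l ?expR_ge0.
rewrite -expRD; have -> : (- J b - d) * n%:R + n%:R * (ln omega + d / 2)
    = n%:R * (rate b - d / 2).
  by rewrite growth_rate //; field.
apply: le_trans lo' _; rewrite ler_nat; apply: card_fset_set_le.
  exact: sub_finite_set (@subIsetr _ _ _) (finite_lamp_ball F n).
move=> x [xn xj]; split=> //; rewrite /cursor_event /= xj; split=> //.
by rewrite /= in_itv /= -ler_norml -xj cursor_ratio_le1.
Unshelve. all: by end_near. Qed.

End LargeDeviations.

(** * Concentration of cursor, hull and lamps *)

Section Concentration.
Variables (R : realType) (F : finGroupType) (r : nat) (rho omega : R).
Hypotheses (hF : #|F| = r.+1) (r0 : (0 < r)%N) (rho1 : 1 < rho)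
  (rhoE : rho ^+ 3 = rho + r%:R)
  (omega1 : 1 < omega) (omegaE : omega ^+ 2 = omega + r%:R).

Notation beta_bar := (beta_bar r omega).
Notation beta_star := (beta_star r rho).

Definition profile n (x : lamplighter F) : R * R * R :=
  (`|(cursor x)%:~R / n%:R|, (hull_length x)%:~R / n%:R, (lamp_count x)%:R / n%:R).

(* On the ball, lamps + hull + backtracking is at most [n], so outside this event
   the backtracking is less than [d * n]. *)
Definition short_event (d : R) n : set (lamplighter F) :=
  [set x | (lamp_count x)%:R + (hull_size x)%:R <= (1 - d) * n%:R].

(** One form for both tails. For [beta_star <= b < 1] the gain is nonnegative below [beta_bar] and
    nonpositive above it, so the event contains the hulls of size at most [b n] in the first case
    and at least [b n] in the second. *)
Definition hull_event (b : R) n : set (lamplighter F) :=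
  [set x | ((hull_size x)%:R - b * n%:R) * hull_gain r b <= 0].

Lemma short_event_decay d : 0 < d -> exists2 c : R, 0 < c &
  \forall n \near \oo, event_prob R (short_event d n) n <= expR (- (c * n%:R)).
Proof.
move=> d0; have lno : 0 < ln omega by exact: ln_gt0.
have dl : 0 < d * ln omega by exact: mulr_gt0.
exists (d * ln omega / 2); first by rewrite divr_gt0.
apply: (event_prob_decay hF r0 rho1 rhoE omega1 omegaE
  (s := (1 - d) * ln omega) (C := ln omega)); first by lra.
move=> n n0; apply: (@count_weight_bound R F r hF _ _ omega^-1).
- by rewrite invr_gt0; apply: lt_trans omega1.
- by move=> x [].
- by move=> x [xs _]; exact: (short_weight r0 omega1 omegaE).
Qed.

Lemma hull_event_decay b : 1 / 2 < b < 1 -> beta_star <= b -> b != beta_bar ->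
  exists2 c : R, 0 < c &
  \forall n \near \oo, event_prob R (hull_event b n) n <= expR (- (c * n%:R)).
Proof.
move=> b1 star_b bne.
have lt_s := tilted_opt_lt_omega r0 rho1 rhoE omega1 omegaE b1 bne.
exists ((ln omega - tilted r 1 b (opt_tilt r b)) / 2); first by rewrite divr_gt0 ?subr_gt0.
apply: (event_prob_decay hF r0 rho1 rhoE omega1 omegaE
  (s := tilted r 1 b (opt_tilt r b)) (C := ln (1 + r%:R * opt_tilt r b))); first by lra.
move=> n n0; apply: (@count_weight_bound R F r hF _ _ (opt_tilt r b)).
- exact: opt_tilt_gt0.
- by move=> x [].
- move=> x [xs xn]; exact: (hull_weight r0 rho1 rhoE omega1 omegaE b1 star_b xn xs).
Qed.

(** Outside the three events the hull is within [d n] of [beta_bar n] and lamps plus hull exceeds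
    [(1 - d) n]. With [m + 2 H <= n + J] and [J <= H] this pins cursor and lamps up to [2 d n]. *)
Lemma profile_cover (d e : R) n x : (0 < n)%N -> 0 < d -> 2 * d <= e ->
  beta_star <= beta_bar - d -> beta_bar + d < 1 -> lamp_ball n x ->
  ~ ball (beta_bar, beta_bar, 1 - beta_bar) e (profile n x) ->
  (short_event d n `|` (hull_event (beta_bar - d) n `|` hull_event (beta_bar + d) n)) x.
Proof.
move=> n0 d0 de star_d bar_d xn; apply: contra_notP => /not_orP[ns /not_orP[nl nr]].
have nR : 0 < n%:R :> R by rewrite ltr0n.
have half := beta_star_half r0 rho1.
have gain b : beta_star <= b -> b < 1 -> 0 <= (beta_bar - b) * hull_gain r b.
  move=> sb b1; apply: (hull_gainE r0 rho1 rhoE omega1 omegaE) => //; lra.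
have gl : 0 <= hull_gain r (beta_bar - d).
  have -> : hull_gain r (beta_bar - d)
      = d^-1 * ((beta_bar - (beta_bar - d)) * hull_gain r (beta_bar - d)).
    by field; rewrite gt_eqF.
  by apply: mulr_ge0; [rewrite invr_ge0; exact: ltW|apply: gain => //; lra].
have gr : hull_gain r (beta_bar + d) <= 0.
  have -> : hull_gain r (beta_bar + d)
      = - (d^-1 * ((beta_bar - (beta_bar + d)) * hull_gain r (beta_bar + d))).
    by field; rewrite gt_eqF.
  rewrite oppr_le0.
  by apply: mulr_ge0; [rewrite invr_ge0; exact: ltW|apply: gain => //; lra].
have hl : (beta_bar - d) * n%:R < (hull_size x)%:R.
  rewrite ltNge; apply/negP => le_h; apply: nl; rewrite /hull_event /=.
  by apply: mulr_le0_ge0 => //; rewrite subr_le0.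
have hr : (hull_size x)%:R < (beta_bar + d) * n%:R.
  rewrite ltNge; apply/negP => le_h; apply: nr; rewrite /hull_event /=.
  by apply: mulr_ge0_le0 => //; rewrite subr_ge0.
have hs : (1 - d) * n%:R < (lamp_count x)%:R + (hull_size x)%:R.
  by rewrite ltNge; apply/negP => le_s; apply: ns.
have le_JH : (`|cursor x|%N)%:R <= (hull_size x)%:R :> R by rewrite ler_nat cursor_hull.
have le_m : (lamp_count x)%:R + 2 * (hull_size x)%:R <= n%:R + (`|cursor x|%N)%:R :> R.
  by rewrite -natrM -!natrD ler_nat; exact: lamp_ball_le.
have dn : 0 < d * n%:R by exact: mulr_gt0.
have den : 2 * (d * n%:R) <= e * n%:R by rewrite mulrA ler_pM2r.
have close (b y : R) : `|b * n%:R - y| < e * n%:R -> ball b e (y / n%:R).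
  rewrite -ball_normE /ball_ /= => h.
  by rewrite -(ltr_pM2r nR) -[X in _ * X](gtr0_norm nR) -normrM mulrBl divfK // gt_eqF.
split; [split|] => /=.
- by rewrite cursor_ratio_abs; apply: close; rewrite ltr_norml; apply/andP; split; lra.
- by rewrite hull_sizeE; apply: close; rewrite ltr_norml; apply/andP; split; lra.
- by apply: close; rewrite ltr_norml; apply/andP; split; lra.
Qed.

Lemma profile_decay (e : R) : 0 < e -> exists2 c : R, 0 < c &
  \forall n \near \oo,
    event_prob R [set x | ~ ball (beta_bar, beta_bar, 1 - beta_bar) e (profile n x)] n
      <= 3 * expR (- (c * n%:R)).
Proof.
move=> e0; have half := beta_star_half r0 rho1.
have lt_bar := beta_star_lt_bar r0 rho1 rhoE omega1 omegaE.
have bar1 := beta_bar_lt1 r0 omega1 omegaE.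
(* [e / 2] because errors double in [profile_cover]; the other bounds keep both hull thresholds
   between [beta_star] and 1. *)
pose d := Num.min (e / 2) (Num.min (beta_bar - beta_star) ((1 - beta_bar) / 2)).
have d0 : 0 < d by rewrite !lt_min; apply/and3P; split; lra.
have [de ds db] : [/\ d <= e / 2, d <= beta_bar - beta_star & d <= (1 - beta_bar) / 2].
  by split; rewrite !ge_min lexx ?orbT.
have [c1 c10 near1] := short_event_decay d0.
have [|||c2 c20 near2] := @hull_event_decay (beta_bar - d); [lra|lra| |].
  by rewrite lt_eqF //; lra.
have [|||c3 c30 near3] := @hull_event_decay (beta_bar + d); [lra|lra| |].
  by rewrite gt_eqF //; lra.
pose c := Num.min c1 (Num.min c2 c3).
have c0 : 0 < c by rewrite !lt_min c10 c20 c30.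
have expc c' n : c <= c' -> expR (- (c' * n%:R)) <= expR (- (c * n%:R)) :> R.
  by move=> cc'; rewrite ler_expR lerN2 ler_wpM2r.
exists c => //; near=> n; have n0 : (0 < n)%N by near: n; exact: nbhs_infty_gt.
apply: (@le_trans _ _ (event_prob R (short_event d n `|`
    (hull_event (beta_bar - d) n `|` hull_event (beta_bar + d) n)) n)).
  apply: event_prob_le => x [nb xn].
  by apply: (profile_cover n0 d0 _ _ _ xn nb); lra.
apply: le_trans (event_probU _ _ _ _) _.
apply: (@le_trans _ _ (expR (- (c1 * n%:R)) + (expR (- (c2 * n%:R)) + expR (- (c3 * n%:R))))).
  apply: lerD; first by near: n.
  by apply: le_trans (event_probU _ _ _ _) _; apply: lerD; near: n.
have h1 : expR (- (c1 * n%:R)) <= expR (- (c * n%:R)) :> R.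
  by apply: expc; rewrite !ge_min lexx ?orbT.
have h2 : expR (- (c2 * n%:R)) <= expR (- (c * n%:R)) :> R.
  by apply: expc; rewrite !ge_min lexx ?orbT.
have h3 : expR (- (c3 * n%:R)) <= expR (- (c * n%:R)) :> R.
  by apply: expc; rewrite !ge_min lexx ?orbT.
lra.
Unshelve. all: by end_near. Qed.

End Concentration.

(** * From counting in the ball to the random elements *)

Theorem theorem1p4 (R : realType) (F : finGroupType) (r : nat)
    (hF : #|F| = r.+1) (hF2 : (2 <= #|F|)%N)
    (rho : R) (hrho1 : 1 < rho) (hrho : rho ^+ 3 = rho + r%:R)
    (d : nat -> measure_display) (T : forall n, measurableType (d n))
    (P : forall n, probability (T n) R)
    (Z : forall n, {RV (P n) >-> lamplighter F})
    (hZ : forall n, uniform_on (Z n) (@lamp_ball F n)) :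
  let omega : R := (1 + Num.sqrt (1 + 4 * r%:R)) / 2 in
  let u : R := r%:R / (r%:R + rho) in
  let bstar : R := (1 + u)^-1 in
  let bbar : R := omega ^+ 2 / (omega ^+ 2 + r%:R) in
  let J (b : R) : R := ln omega - growth_spectrum F b in
  let p n (w : T n) : R := (cursor (Z n w))%:~R / n%:R in
  let l n (w : T n) : R := (hull_length (Z n w))%:~R / n%:R in
  let m n (w : T n) : R := (lamp_count (Z n w))%:R / n%:R in
  [/\ (forall e : R, 0 < e ->
         exponentially_small (fun n => P n
           [set w | ~ ball (bbar, bbar, 1 - bbar) e
                      (`|p n w|, l n w, m n w)])),
      [/\ cvg_in_prob P (fun n w => `|p n w|) bbar,
          cvg_in_prob P l bbar,
          cvg_in_prob P m (1 - bbar) &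
          cvg_in_prob P (fun n w => l n w - `|p n w|) 0],
      large_deviation_principle (fun n A => P n [set w | A (p n w)]) J,
      (forall b : R, -1 <= b <= 1 ->
         (J b = 0 <-> b = bbar \/ b = - bbar)) &
      (* [J] is even with a corner at [0]: on the symmetric interval it is
         an affine function of [`|b|]. *)
      exists s c : R, forall b : R, - bstar <= b <= bstar ->
        J b = s * `|b| + c].
Proof.
move=> omega u bstar bbar J p l m.
have r0 : (0 < r)%N by rewrite hF in hF2.
have rR : 1 <= r%:R :> R by rewrite ler1n.
have omega1 : 1 < omega.
  have : 1 < Num.sqrt (1 + 4 * r%:R) :> R.
    by rewrite -[X in X < _](sqrtr1 R) ltr_sqrt; lra.
  by rewrite /omega ltr_pdivlMr //; lra.
have omegaE : omega ^+ 2 = omega + r%:R.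
  have : Num.sqrt (1 + 4 * r%:R) ^+ 2 = 1 + 4 * r%:R :> R by rewrite sqr_sqrtr //; lra.
  by rewrite /omega; move: (Num.sqrt _) => s sE; rewrite expr_div_n sqrrD sE; field.
(* Uniformity turns each probability into a counting ratio. *)
have PE n (A : set (lamplighter F)) : P n [set w | A (Z n w)] = (event_prob R A n)%:E.
  exact: hZ.
have meas n (A : set (lamplighter F)) : measurable [set w | A (Z n w)].
  exact: (@measurable_funPTI _ _ _ _ (Z n) A).
have decay (e : R) : 0 < e -> exponentially_small (fun n => P n
    [set w | ~ ball (bbar, bbar, 1 - bbar) e (`|p n w|, l n w, m n w)]).
  move=> e0; have [c c0 near_c] := profile_decay hF r0 hrho1 hrho omega1 omegaE e0.
  apply: (@exponentially_small_near R _ 3 c) => // [n|].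
    exact/probability_le1/(meas n [set x | ~ ball (bbar, bbar, 1 - bbar) e (profile R n x)]).
  apply: filterS near_c => n le_n; rewrite -lee_fin in le_n; apply: le_trans le_n.
  by rewrite -PE.
(* Covers any function of the triple that is continuous at the limit point: the three coordinates,
   and the difference of hull and cursor. *)
have in_prob (f : R * R * R -> R) (y : R) :
    (forall e : R, 0 < e -> exists2 del : R, 0 < del & forall v,
        ball (bbar, bbar, 1 - bbar) del v -> `|f v - y| < e) ->
    cvg_in_prob P (fun n w => f (`|p n w|, l n w, m n w)) y.
  move=> f_cont e e0; have [del del0 f_del] := f_cont e e0.
  have := exponentially_small_cvg (fun n => measure_ge0 _ _) (decay del del0).
  apply: (squeeze_cvge _ (cvg_cst 0%E)).
  near=> n; rewrite measure_ge0 /=; apply: le_measure; rewrite ?inE.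
  - exact: (meas n [set x | e <= `|f (profile R n x) - y|]).
  - exact: (meas n [set x | ~ ball (bbar, bbar, 1 - bbar) del (profile R n x)]).
  - by move=> w /= le_e /f_del; rewrite ltNge le_e.
have ballE (del : R) v : ball (bbar, bbar, 1 - bbar) del v ->
    [/\ `|v.1.1 - bbar| < del, `|v.1.2 - bbar| < del & `|v.2 - (1 - bbar)| < del].
  by move=> [[]]; rewrite -!ball_normE /ball_ /= !(distrC _ v.1.1) !(distrC _ v.1.2) (distrC _ v.2).
split => //.
- split.
  + by apply: (in_prob (fun v => v.1.1)) => e e0; exists e => // v /ballE[].
  + by apply: (in_prob (fun v => v.1.2)) => e e0; exists e => // v /ballE[].
  + by apply: (in_prob (fun v => v.2)) => e e0; exists e => // v /ballE[].
  + apply: (in_prob (fun v => v.1.2 - v.1.1)) => e e0; exists (e / 2); first by rewrite divr_gt0.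
    move=> v /ballE[]; rewrite !ltr_norml => /andP[? ?] /andP[? ?] _.
    by apply/andP; split; lra.
- have -> : (fun n A => P n [set w | A (p n w)])
      = (fun n A => (@event_prob R F (cursor_event n A) n)%:E).
    by apply/funext => n; apply/funext => A; exact: PE.
  split=> [A _ A1|U oU].
    exact: (ldp_upper hF r0 hrho1 hrho omega1 omegaE A1).
  exact: (ldp_lower hF r0 hrho1 hrho omega1 omegaE oU).
- by move=> b; exact: (rate_fun_eq0 hF r0 hrho1 hrho omega1 omegaE).
- by exists (- ln rho), (ln omega - ln rho) => b; exact: (rate_fun_affine omega hF r0 hrho1 hrho).
Unshelve. all: by end_near. Qed.
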